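(* $W(n)\sim n\cdot2^{3^{n-1}}$ as $n\to\infty$. More precisely, $$Z_\cap(n)=\sum_{j=1}^{n}(-1)^{j+1}\binom nj\,2^{3^{n-j}}\;\sim\;n\cdot2^{3^{n-1}},$$ and the following unconditional, non-asymptotic upper bound holds: $$\frac{R(n)}{Z_\cap(n)}\;\le\;\frac{\lambda(n)}{n-1}\cdot2^{-(2^{n-1}-2)}\qquad(n\ge3),$$ together with the matching lower bound $$\frac{R(n)}{Z_\cap(n)}\;\ge\;\Bigl(\frac34-o(1)\Bigr)\cdot2^{-(2^{n-1}-2)}\qquad(n\to\infty).$$ Since $\log_2\lambda(n)=O(2^{n}n^{-1/2})=o(2^{n-1})$, these two bounds together give the sharp exponent $$\log_2\frac{Z_\cap(n)}{R(n)}=2^{n-1}\bigl(1+o(1)\bigr),$$ so the exponent $2^{n-1}$ in the suppression factor is sharp at the leading scale. In fact the additive constant is also determined: as $n\to\infty$, $$R(n)=\Bigl(\frac34+o(1)\Bigr)\,n\cdot2^{M_n^{*}}\qquad\text{and}\qquad\log_2\frac{Z_\cap(n)}{R(n)}=2^{n-1}-2+\log_2\tfrac43+o(1),$$ where $M_n^{*}=3^{n-1}-2^{n-1}+2$.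
   Context: $[n]=\{1,\dots,n\}$; $V_n$ is the set of nonempty subsets of $[n]$. A family $\mathcal F\subseteq V_n$ is intersecting if $A\cap B\ne\varnothing$ for all $A,B\in\mathcal F$ (the empty family is intersecting). Its kernel is $\ker\mathcal F=\bigcap_{S\in\mathcal F}S$, with $\ker\varnothing=[n]$. It is trivial (kernel-bearing, condensed) if $\ker\mathcal F\ne\varnothing$, and non-trivial (kernel-free, non-condensed) if $\ker\mathcal F=\varnothing$. The weight is $w(S)=2^{2^{n-|S|}}-1$ for $S\in V_n$. $W(n)=\sum_{\mathcal F}\prod_{S\in\mathcal F}w(S)$ over all intersecting families $\mathcal F\subseteq V_n$ (the empty product is $1$); $Z_\cap(n)$ is the same sum restricted to trivial families and $R(n)$ the same sum restricted to non-trivial families, so $W(n)=Z_\cap(n)+R(n)$. $\lambda(n)$ is the number of inclusion-maximal intersecting families $\mathcal F\subseteq V_n$ with $\ker\mathcal F=\varnothing$. The number $M_n^{*}=3^{n-1}-2^{n-1}+2$ is the maximum of $\sum_{S\in\mathcal M}2^{n-|S|}$ over all such maximal families $\mathcal M$ (for $n\ge3$). *)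

(* Defs.v *)
From HB Require Import structures.
From mathcomp Require Import all_boot all_order all_algebra.
From mathcomp Require Import all_classical all_reals all_analysis.

Set Implicit Arguments.
Unset Strict Implicit.
Unset Printing Implicit Defensive.

Import Order.TTheory GRing.Theory Num.Theory.
Import numFieldNormedType.Exports.

Section IntersectingFamilies.
Variable n : nat.
Implicit Types (S : {set 'I_n}) (F : {set {set 'I_n}}).

(* The ground set {1, ..., n} is represented by 'I_n = {0, ..., n-1}. *)
Definition nonempty_subsets : {set {set 'I_n}} := [set S | S != finset.set0]%SET.

Definition pairwise_meeting F : bool :=
  [forall A in F, forall B in F, A :&: B != finset.set0]%SET.

Definition intersecting F : bool :=
  (F \subset nonempty_subsets) && pairwise_meeting F.

(* The empty intersection is [set: 'I_n], so the kernel of the empty family is the whole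
   ground set. *)
Definition kernel F : {set 'I_n} := (\bigcap_(S in F) S)%SET.

Definition trivial_family F : bool := (kernel F != finset.set0)%SET.

(* The truncated subtractions are exact: #|S| <= n and 1 <= 2 ^ _. *)
Definition weight S : nat := 2 ^ (2 ^ (n - #|S|)) - 1.

Definition family_weight F : nat := \prod_(S in F) weight S.

(* [maxset intersecting F]: maximal for inclusion among all intersecting
   families. *)
Definition maximal_nontrivial F : bool :=
  maxset intersecting F && ~~ trivial_family F.

End IntersectingFamilies.

Definition W (n : nat) : nat :=
  \sum_(F : {set {set 'I_n}} | intersecting F) family_weight F.

Definition Zcap (n : nat) : nat :=
  \sum_(F : {set {set 'I_n}} | intersecting F && trivial_family F)
    family_weight F.

Definition Rnt (n : nat) : nat :=
  \sum_(F : {set {set 'I_n}} | intersecting F && ~~ trivial_family F)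
    family_weight F.

Definition lambda (n : nat) : nat :=
  #|[set F : {set {set 'I_n}} | maximal_nontrivial F]%SET|.

(* Without truncation for every n >= 1. *)
Definition Mstar (n : nat) : nat := 3 ^ n.-1 - 2 ^ n.-1 + 2.

Definition log2 (R : realType) (x : R) : R := (ln x / ln 2)%R.

(* Main.v *)
From mathcomp Require Import all_boot all_order all_algebra.
From mathcomp Require Import zify ring lra.
Require Import Defs.

(** Inclusion-exclusion over the kernel gives [Zcap] exactly.  A maximal
    intersecting family [M] contains exactly one of [S] and its complement, so
    for every point [i] the defect [3 ^ (n - 1) - mass M] of its exponent
    [mass M] (the sum of [2 ^ (n - |S|)] over [M]) is the sum of
    [2 ^ |T| - 2 ^ (n - |T|)] over the members [T] avoiding [i].  By Katona's
    shadow theorem such an [M] has at least as many of these [T] of size [n - t]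
    as of size [t <= n / 2], so levels [t] and [n - t] together contribute
    nonnegatively; levels [1] and [n - 1] contribute [2 ^ (n - 1) - 2] for
    non-trivial [M], and levels [2] and [n - 2] another [2 ^ (n - 2) - 4] unless
    the two-element members form a full star, that is, unless [M] is a
    Hilton-Milner family.  As [log2 lambda = O(2 ^ n / sqrt n)] by Hansel's
    bound on the number of monotone functions, the [n] Hilton-Milner families
    dominate [Rnt].  Each must retain the complement of its centre, whose weight
    is [3] out of [3 + 1]: hence the constant [3 / 4]. *)

Set Implicit Arguments.
Unset Strict Implicit.
Unset Printing Implicit Defensive.
Import Order.TTheory GRing.Theory Num.Theory.

(** * Katona's shadow theorem *)

Lemma prod_add1_subset (R : comNzSemiRingType) (I : finType) (D : {set I})
    (x : I -> R) :
  (\prod_(i in D) (x i + 1) =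
   \sum_(J : {set I} | J \subset D) \prod_(i in J) x i)%R.
Proof.
under eq_bigl do rewrite -[_ \in D]andTb.
rewrite big_mkcondr /=.
transitivity (\prod_i ((if i \in D then x i else 0) + 1))%R.
  by apply: eq_bigr => i _; case: ifP; rewrite ?add0r.
rewrite bigA_distr [RHS]big_mkcond /=; apply: eq_bigr => J _.
case: ifPn => [/subsetP JD|/subsetPn [i iJ iD]].
  rewrite [RHS]big_mkcond /=; apply: eq_bigr => i _.
  by case: ifP => // /JD ->.
by rewrite (bigD1 i) //= iJ (negbTE iD) mul0r.
Qed.

Lemma prodn_add1_subset (I : finType) (D : {set I}) (x : I -> nat) :
  \prod_(i in D) (x i).+1 =
  \sum_(J : {set I} | J \subset D) \prod_(i in J) x i.
Proof.
under eq_bigr do rewrite -addn1.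
exact: (@prod_add1_subset nat).
Qed.

Lemma sum_sign_subset (R : comNzRingType) (I : finType) (D : {set I}) :
  (\sum_(J : {set I} | J \subset D) (-1) ^+ #|J| = (D == set0)%:R :> R)%R.
Proof.
transitivity (\prod_(i in D) (-1 + 1 : R))%R.
  by rewrite prod_add1_subset; apply: eq_bigr => J _; rewrite prodr_const.
rewrite addNr prodr_const expr0n cards_eq0 //.
Qed.

Lemma card_subset_interval (T : finType) (Y Z : {set T}) m :
  Y \subset Z -> #|Y| <= m ->
  #|[set B : {set T} | [&& Y \subset B, B \subset Z & #|B| == m]]| =
  'C(#|Z| - #|Y|, m - #|Y|).
Proof.
move=> YZ Ym.
have -> : #|Z| - #|Y| = #|Z :\: Y| by rewrite cardsD (setIidPr YZ).
rewrite -cards_draws.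
rewrite -[RHS](card_in_imset (f := fun B => Y :|: B)); last first.
  move=> B C; rewrite !inE !subsetD => /andP[/andP[_ BY] _] /andP[/andP[_ CY] _].
  move=> /(congr1 (fun X => X :\: Y)).
  by rewrite !setDUl setDv !set0U => E; rewrite -(setDidPl BY) -(setDidPl CY).
apply: eq_card => B; rewrite !inE; apply/idP/imsetP.
  case/and3P=> YB BZ /eqP Bm; exists (B :\: Y).
    by rewrite inE setSD //= cardsD (setIidPr YB) Bm.
  by rewrite setUC setDE setUIl [~: Y :|: Y]setUC setUCr setIT; apply/esym/setUidPl.
case=> C; rewrite inE subsetD => /andP[/andP[CZ CY] /eqP Cm] ->.
rewrite subsetUl subUset YZ CZ /= cardsU Cm.
have -> : Y :&: C = set0 by apply/eqP; rewrite setI_eq0 disjoint_sym.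
by rewrite cards0 subn0 subnKC.
Qed.

Section Katona.
Variables (T : finType) (U : {set T}) (t : nat) (A : {set {set T}}).
Hypothesis t_gt0 : 0 < t.
Hypothesis le_tU : t.*2 <= #|U|.+1.
Hypothesis sAU : forall X, X \in A -> X \subset U.
Hypothesis cardA : forall X, X \in A -> #|X| = t.
Hypothesis meetA : forall X Y, X \in A -> Y \in A -> X :&: Y != set0.

(** These are the sets of size [t - 1] inside some complement [U :\: X], that is, the shadow of the
    complemented family. *)
Let shadow : {set {set T}} :=
  [set B : {set T} |
     [&& B \subset U, #|B| == t.-1 & [exists X in A, [disjoint B & X]]]].

(** For [X] in [A] and [Y] disjoint from [X], the denominator counts the sets of size [t - 1]
    between [Y] and [U :\: X]; it cancels in [sum_coeff]. *)
Let coeff (Y : {set T}) : rat :=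
  ((-1) ^+ #|Y| / ('C(#|U| - t - #|Y|, t.-1 - #|Y|))%:R)%R.

(** After exchanging the sums only the [Y] inside [X' :\: X] survive, with coefficient
    [(-1) ^+ #|Y|]. Their alternating sum vanishes unless [X'] lies in [X], and both have size
    [t]. *)
Let sum_coeff X X' : X \in A -> X' \in A ->
  (\sum_(B in shadow)
     ([disjoint B & X]%:R * \sum_(Y : {set T} | Y \subset X' :&: B) coeff Y) =
   (X == X')%:R :> rat)%R.
Proof.
move=> XA X'A.
transitivity (\sum_(Y : {set T} | Y \subset X' :\: X) coeff Y *
  #|[set B in shadow | [disjoint B & X] & Y \subset B]|%:R)%R.
  rewrite [RHS]big_mkcond /=.
  under eq_bigr => B _ do rewrite big_distrr /= big_mkcond /=.
  rewrite exchange_big /=; apply: eq_bigr => Y _.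
  rewrite subsetD.
  have -> : (\sum_(i in shadow)
        (if Y \subset X' :&: i then [disjoint i & X]%:R * coeff Y else 0)
    = if Y \subset X'
      then coeff Y * #|[set B in shadow | [disjoint B & X] & Y \subset B]|%:R
      else 0)%R.
    case: ifP => YX'; last first.
      by rewrite big1 // => B _; rewrite subsetI YX'.
    rewrite -sum1_card natr_sum big_distrr /= [RHS]big_mkcond [LHS]big_mkcond /=.
    apply: eq_bigr => B _; rewrite !inE subsetI YX' /=.
    case: (B \subset U) => //=; case: (_ == _) => //=; case: [exists _ in _, _] => //=.
    by case: (Y \subset B); case: [disjoint _ & _]; rewrite /= ?mul1r ?mulr1 ?mul0r.
  case: (Y \subset X') => //=; case: ifPn => // nd.
  rewrite (_ : [set B in shadow | [disjoint B & X] & Y \subset B] = set0) ?cards0 ?mulr0 //.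
  apply/setP => B; rewrite !inE.
  apply/negP => /andP[_ /andP[BX YB]]; case/negP: nd; exact: disjointWl BX.
transitivity (\sum_(Y : {set T} | Y \subset X' :\: X) (-1) ^+ #|Y| : rat)%R.
  apply: eq_bigr => Y; rewrite subsetD => /andP[YX' YX].
  (* Here the intersecting hypothesis enters: [Y] misses [X], so it is not all of [X']. *)
  have Yt : #|Y| <= t.-1.
    rewrite -ltnS prednK // -(cardA X'A); apply: proper_card.
    rewrite properEneq YX' andbT; apply: contraNneq (meetA X'A XA) => <-.
    by rewrite setI_eq0.
  have YUX : Y \subset U :\: X by rewrite subsetD YX (subset_trans YX' (sAU X'A)).
  have -> : [set B in shadow | [disjoint B & X] & Y \subset B] =
    [set B : {set T} | [&& Y \subset B, B \subset U :\: X & #|B| == t.-1]].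
    apply/setP => B; rewrite !inE subsetD.
    case YB: (Y \subset B); case BU: (B \subset U); case BX: [disjoint B & X];
      case Bt : (#|B| == _); rewrite ?andbF ?andbT //=.
    by apply/existsP; exists X; rewrite XA BX.
  rewrite card_subset_interval // cardsD (setIidPr (sAU XA)) (cardA XA) /coeff.
  rewrite divfK // pnatr_eq0 -lt0n bin_gt0; lia.
rewrite sum_sign_subset setD_eq0; congr (_%:R)%R; congr (nat_of_bool _).
apply/idP/eqP => [XX'|-> //]; apply/esym/eqP.
by rewrite eqEcard XX' !cardA /=.
Qed.

(* The matrix [B disjoint X] has full row rank: [coeff] yields an explicit right inverse. *)
Lemma card_le_disjoint_sets :
  #|A| <= #|[set B : {set T} |
     [&& B \subset U, #|B| == t.-1 & [exists X in A, [disjoint B & X]]]]|.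
Proof.
pose V := (\matrix_(i < #|A|, j < #|shadow|)
  [disjoint enum_val j & enum_val i]%:R : 'M[rat]_(_, _))%R.
pose C := (\matrix_(j < #|shadow|, i < #|A|)
  \sum_(Y : {set T} | Y \subset enum_val i :&: enum_val j) coeff Y : 'M[rat]_(_, _))%R.
apply: (@mulmx1_min rat _ _ V C).
apply/matrixP => i i'; rewrite !mxE.
transitivity ((enum_val i == enum_val i')%:R : rat)%R; last by rewrite (inj_eq enum_val_inj).
rewrite -(sum_coeff (enum_valP i) (enum_valP i')) [RHS]big_enum_val /=.
by apply: eq_bigr => j _; rewrite !mxE.
Qed.
End Katona.

(** * Kernels and the exact formula *)

Section Weights.
Variable n : nat.
Implicit Types (S T J : {set 'I_n}) (F A B M : {set {set 'I_n}}).

(** The binary logarithm of the total weight of all subfamilies of [A], by [sum_family_weight]. *)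
Definition mass A : nat := \sum_(S in A) 2 ^ (n - #|S|).

Definition star J : {set {set 'I_n}} := [set S : {set 'I_n} | J \subset S].

Lemma weightS S : (weight S).+1 = 2 ^ (2 ^ (n - #|S|)).
Proof. by rewrite /weight subn1 prednK // expn_gt0. Qed.

Lemma sum_family_weight A :
  \sum_(F : {set {set 'I_n}} | F \subset A) family_weight F = 2 ^ mass A.
Proof.
rewrite /family_weight -prodn_add1_subset /mass expn_sum.
by apply: eq_bigr => S _; exact: weightS.
Qed.

(** Over complements, the sum runs through the subsets [C] of [~: J] with terms [2 ^ #|C|], hence is
    a product of factors [1 + 2]. *)
Lemma mass_star J : mass (star J) = 3 ^ (n - #|J|).
Proof.
have card_C S : n - #|S| = #|~: S| by rewrite [#|~: S|]cardsCs setCK card_ord.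
transitivity (\prod_(i in ~: J) (2.+1)).
  rewrite prodn_add1_subset /mass (reindex_inj (inv_inj (@setCK _))) /=.
  apply: eq_big => [S|S]; first by rewrite inE -setCS setCK.
  by move=> _; rewrite prod_nat_const card_C setCK.
by rewrite prod_nat_const card_C.
Qed.

Lemma sub_kernel J F : (J \subset kernel F) = (F \subset star J).
Proof.
apply/bigcapsP/subsetP => [JF S SF|JF S /JF]; first by rewrite inE; exact: JF.
by rewrite inE.
Qed.

Lemma kernelS A B : A \subset B -> kernel B \subset kernel A.
Proof. by move=> AB; rewrite sub_kernel (subset_trans AB) // -sub_kernel. Qed.

Lemma trivialS A B : A \subset B -> trivial_family B -> trivial_family A.
Proof.
move=> /kernelS AB; rewrite /trivial_family; apply: contraNneq => A0.
by rewrite -subset0 -A0.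
Qed.

Lemma trivialP F : reflect (exists i, F \subset star [set i]) (trivial_family F).
Proof.
apply: (iffP (set0Pn _)) => -[i iF]; exists i.
  by rewrite -sub_kernel sub1set.
by rewrite -sub1set sub_kernel.
Qed.

Lemma trivial_intersecting F : trivial_family F -> intersecting F.
Proof.
move=> /trivialP[i /subsetP Fi].
have iF S : S \in F -> i \in S by move=> /Fi; rewrite inE sub1set.
apply/andP; split.
  by apply/subsetP => S /iF iS; rewrite inE; apply/set0Pn; exists i.
apply/'forall_implyP => S SF; apply/'forall_implyP => T TF.
by apply/set0Pn; exists i; rewrite inE !iF.
Qed.

(** Double counting of pairs of a family and a set of size [j] inside its kernel. Families that are
    not intersecting have an empty kernel, so they contribute only for [j = 0]. *)
Lemma sum_bin_kernel j :
  \sum_(F : {set {set 'I_n}}) family_weight F * 'C(#|kernel F|, j) =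
  'C(n, j) * 2 ^ (3 ^ (n - j)).
Proof.
transitivity (\sum_(F : {set {set 'I_n}}) \sum_(J : {set 'I_n} | #|J| == j)
    (if F \subset star J then family_weight F else 0)).
  apply: eq_bigr => F _; rewrite -cards_draws -sum1_card big_distrr /=.
  rewrite [RHS]big_mkcond [LHS]big_mkcond /=; apply: eq_bigr => J _.
  by rewrite inE sub_kernel; case: (_ \subset _); case: (_ == _); rewrite ?muln1.
rewrite exchange_big /=.
transitivity (\sum_(J : {set 'I_n} | #|J| == j) 2 ^ (3 ^ (n - j))).
  apply: eq_bigr => J /eqP <-.
  by rewrite -big_mkcond sum_family_weight mass_star.
rewrite sum_nat_cond_const; congr (_ * _).
by rewrite -[in RHS](card_ord n) -card_draws; apply: eq_card => J; rewrite !inE.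
Qed.
End Weights.

Lemma ZcapE n :
  Zcap n = \sum_(F : {set {set 'I_n}} | trivial_family F) family_weight F.
Proof.
by apply: eq_bigl => F; rewrite andb_idl //; exact: trivial_intersecting.
Qed.

Lemma sum_sign_bin n k : (k <= n)%N ->
  (\sum_(1 <= j < n.+1) (-1) ^+ j.+1 * ('C(k, j))%:Z = (0 < k)%N%:Z)%R.
Proof.
move=> kn.
have H : (\sum_(0 <= j < n.+1) (-1) ^+ j * ('C(k, j))%:Z = (k == 0)%N%:Z)%R.
  rewrite (@big_cat_nat _ _ _ k.+1) //= [X in (_ + X)%R]big_nat_cond.
  rewrite [X in (_ + X)%R]big1 => [|j]; last first.
    by rewrite andbT => /andP[kj _]; rewrite bin_small ?mulr0.
  rewrite addr0 big_mkord.
  have := exprDn (1 : int)%R (-1)%R k; rewrite subrr expr0n natz => ->.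
  apply: eq_bigr => i _; rewrite expr1n mul1r.
  by rewrite -[in RHS]mulr_natr natz.
move: H; rewrite big_ltn // bin0 expr0 mulr1.
under [in X in _ -> X]eq_bigr do rewrite exprS mulN1r mulNr.
rewrite sumrN lt0n; set s := bigop _ _ _; case: (k == 0) => /=; move: s => s; lia.
Qed.

Lemma Zcap_formula n :
  ((Zcap n)%:Z =
   \sum_(1 <= j < n.+1) (-1) ^+ j.+1 * ('C(n, j))%:Z * 2 ^+ (3 ^ (n - j))%N)%R.
Proof.
have E j : (('C(n, j))%:Z * 2 ^+ (3 ^ (n - j))%N =
    \sum_(F : {set {set 'I_n}}) (family_weight F)%:Z * ('C(#|kernel F|, j))%:Z)%R.
  have := sum_bin_kernel n j => /(congr1 Posz).
  rewrite PoszM -!natz natrX => <-; rewrite natr_sum; apply: eq_bigr => F _.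
  by rewrite natrM !natz.
under eq_bigr => j _ do rewrite -mulrA E big_distrr /=.
rewrite exchange_big /= ZcapE -natz natr_sum big_mkcond /=.
apply: eq_bigr => F _.
under eq_bigr => j _ do rewrite mulrCA.
rewrite -big_distrr /= sum_sign_bin; last by rewrite -[leqRHS](card_ord n) max_card.
rewrite lt0n cards_eq0 natz /trivial_family; case: ifP; lia.
Qed.

Lemma Zcap_le n : Zcap n <= n * 2 ^ (3 ^ n.-1).
Proof.
rewrite -subn1 -[X in X * 2 ^ (3 ^ (n - 1))](bin1 n) -sum_bin_kernel ZcapE big_mkcond /=.
apply: leq_sum => F _; rewrite bin1 /trivial_family -card_gt0.
by case: ifP => // k_gt0; rewrite leq_pmulr.
Qed.

(** A Bonferroni inequality: a kernel of size [k] satisfies [k <= (0 < k) + 'C(k, 2)]. *)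
Lemma Zcap_ge n : n * 2 ^ (3 ^ n.-1) <= Zcap n + 'C(n, 2) * 2 ^ (3 ^ (n - 2)).
Proof.
rewrite -subn1 -[X in X * 2 ^ (3 ^ (n - 1))](bin1 n) -!sum_bin_kernel ZcapE.
rewrite [X in _ <= X + _]big_mkcond /=.
rewrite -big_split /=; apply: leq_sum => F _.
rewrite bin1 /trivial_family -card_gt0.
have : #|kernel F| <= (0 < #|kernel F|) + 'C(#|kernel F|, 2).
  case: #|kernel F| => [|k] //; rewrite binS bin1; lia.
case: ifP => _ H; rewrite -?mulnS leq_mul2l H orbT //.
Qed.

Lemma WE n : W n = Zcap n + Rnt n.
Proof. by rewrite /W (bigID (@trivial_family n)). Qed.

(** * Maximal non-trivial families *)

Section MaximalFamilies.
Variable n : nat.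
Implicit Types (S T X Y : {set 'I_n}) (F M : {set {set 'I_n}}) (i j : 'I_n).

Lemma intersectingP F :
  reflect ((forall S, S \in F -> S != set0) /\
           (forall S T, S \in F -> T \in F -> S :&: T != set0))
          (intersecting F).
Proof.
apply: (iffP andP) => -[H1 H2]; split.
- by move=> S SF; move/subsetP: H1 => /(_ S SF); rewrite inE.
- by move=> S T SF TF; move/'forall_implyP: H2 => /(_ S SF) /'forall_implyP /(_ T TF).
- by apply/subsetP => S SF; rewrite inE; exact: H1.
- by apply/'forall_implyP => S SF; apply/'forall_implyP => T TF; exact: H2.
Qed.

Variable M : {set {set 'I_n}}.
Hypothesis maxM : maxset (@intersecting n) M.

Lemma max_meet S T : S \in M -> T \in M -> S :&: T != set0.
Proof. by case/maxsetP: maxM => /intersectingP[_ H] _; exact: H. Qed.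

Lemma max_neq0 S : S \in M -> S != set0.
Proof. by case/maxsetP: maxM => /intersectingP[H _] _; exact: H. Qed.

Lemma max_add S : S != set0 -> (forall T, T \in M -> S :&: T != set0) -> S \in M.
Proof.
move=> S0 SM; case/maxsetP: maxM => _ /(_ (S |: M)) <-; rewrite ?setU11 ?subsetUr //.
apply/intersectingP; split=> [T|T1 T2]; rewrite !inE.
  by case/predU1P=> [->//|]; exact: max_neq0.
case/predU1P=> [->|T1M] /predU1P[->|T2M]; rewrite ?setIid //.
- exact: SM.
- by rewrite setIC; exact: SM.
- exact: max_meet.
Qed.

Lemma max_up S T : S \in M -> S \subset T -> T \in M.
Proof.
move=> SM ST; apply: max_add => [|X XM].
  by apply: contraNneq (max_neq0 SM) => T0; rewrite -subset0 -T0.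
apply: contraNneq (max_meet SM XM) => TX0.
by rewrite -subset0 -TX0 setSI.
Qed.

(** If [~: S] is not in [M], no member lies inside [~: S], so [S] meets every member and maximality
    puts it in [M]. *)
Lemma max_setC S : 0 < n -> (~: S \in M) = (S \notin M).
Proof.
move=> n_gt0; apply/idP/idP => [CSM|].
  by apply/negP => SM; have := max_meet CSM SM; rewrite setIC setICr eqxx.
apply: contraR => CSM.
have setTM : [set: 'I_n] \in M.
  apply: max_add => [|T TM]; last by rewrite setTI max_neq0.
  by apply/set0Pn; exists (Ordinal n_gt0).
apply: max_add => [|T TM].
  by apply: contraNneq CSM => ->; rewrite setC0.
apply: contraNneq CSM => ST0; apply: max_up TM _.
by rewrite -disjoints_subset -setI_eq0 setIC ST0.
Qed.

(** * Level counts and the mass of a maximal family *)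

Definition level i t := #|[set T in M | (i \notin T) && (#|T| == t)]|.

(** Katona's theorem in [[set~ i]], of size [n - 1]. A set of size [t - 1] disjoint from a member
    [X] has a complement there of size [n - t], which contains [X] and so belongs to [M]. *)
Lemma level_compl i t : t.*2 <= n -> level i t <= level i (n - t).
Proof.
case: t => [|t] t2.
  rewrite /level [X in X <= _](_ : _ = 0) //; apply: eq_card0 => T; rewrite !inE.
  apply/negP => /and3P[TM _]; rewrite cards_eq0; apply/negP; exact: max_neq0.
have n_gt0 : 0 < n by lia.
have cardU : #|[set~ i]| = n.-1 by rewrite cardsC1 card_ord.
set L := [set T in M | (i \notin T) && (#|T| == t.+1)].
have LP X : X \in L -> [/\ X \in M, i \notin X & #|X| = t.+1].
  by rewrite inE => /and3P[? ? /eqP].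
have K := @card_le_disjoint_sets _ [set~ i] t.+1 L isT.
have {}K : #|L| <= #|[set B : {set 'I_n} |
     [&& B \subset [set~ i], #|B| == t & [exists X in L, [disjoint B & X]]]]|.
  apply: K; first by rewrite cardU; lia.
  - by move=> X /LP[_ iX _]; rewrite subsetC sub1set inE.
  - by move=> X /LP[].
  - by move=> X Y /LP[XM _ _] /LP[YM _ _]; exact: max_meet.
apply: leq_trans K _; rewrite /level.
rewrite -(card_in_imset (f := fun X => [set~ i] :\: X)); last first.
  move=> X Y; rewrite !inE => /andP[Xi _] /andP[Yi _].
  move=> /(congr1 (fun Z : {set 'I_n} => [set~ i] :\: Z)).
  by rewrite !setDDr !setDv !set0U (setIidPr Xi) (setIidPr Yi).
apply/subset_leq_card/subsetP => _ /imsetP[B + ->].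
rewrite inE => /and3P[Bi /eqP Bt /exists_inP[X /LP[XM iX Xt]] BX].
rewrite !inE eqxx andbF /= cardsD (setIidPr Bi) cardU Bt.
have -> : n.-1 - t = n - t.+1 by lia.
rewrite eqxx andbT; apply: max_up XM _.
by rewrite subsetD disjoint_sym BX andbT subsetC sub1set inE.
Qed.

(** The star of [i] arises from [M] by replacing each member that avoids [i] by its complement. Both
    sides are sums so that no truncated subtraction occurs. *)
Lemma mass_level i :
  mass M + \sum_(t < n.+1) level i t * 2 ^ t =
  3 ^ n.-1 + \sum_(t < n.+1) level i t * 2 ^ (n - t).
Proof.
have n_gt0 : 0 < n by case: i => k /=; lia.
have levelE (f : nat -> nat) :
    \sum_(t < n.+1) level i t * f t = \sum_(T in M | i \notin T) f #|T|.
  rewrite (partition_big (fun T : {set 'I_n} => inord #|T| : 'I_n.+1) xpredT) //=.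
  apply: eq_bigr => t _; rewrite /level -sum1_card big_distrl /=.
  have cT (T : {set 'I_n}) : (inord #|T| == t) = (#|T| == t).
    by rewrite -val_eqE /= inordK // ltnS -[leqRHS](card_ord n) max_card.
  apply: eq_big => [T|T]; first by rewrite cT !inE andbA.
  by rewrite inE mul1n => /and3P[_ _ /eqP ->].
rewrite (levelE (fun t => 2 ^ t)) (levelE (fun t => 2 ^ (n - t))).
have := mass_star [set i]; rewrite cards1 subn1 => <-.
rewrite /mass (bigID (fun S => i \in S)) /= [in RHS](bigID (fun S => S \in M)) /=.
rewrite -!addnA; congr (_ + _).
  by apply: eq_bigl => S; rewrite !inE sub1set andbC.
rewrite addnC; congr (_ + _).
rewrite [RHS](reindex_inj (inv_inj (@setCK _))) /=.
apply: eq_big => [T|T _]; first by rewrite !inE sub1set inE max_setC // negbK andbC.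
by congr (2 ^ _); rewrite [#|T|]cardsCs card_ord.
Qed.

Hypothesis ntM : ~~ trivial_family M.

Lemma max_no_singleton i : [set i] \notin M.
Proof.
apply: contraNN ntM => iM; apply/trivialP; exists i.
apply/subsetP => S SM; rewrite inE sub1set.
have /set0Pn[j] := max_meet iM SM; by rewrite !inE => /andP[/eqP ->].
Qed.

Lemma level1 i : level i 1 = 0.
Proof.
apply: eq_card0 => T; rewrite !inE; apply/negP => /and3P[TM _ /cards1P[j Tj]].
by move: TM; rewrite Tj (negbTE (max_no_singleton j)).
Qed.

Lemma level_predn i : 0 < level i n.-1.
Proof.
have n_gt0 : 0 < n by case: i => k /=; lia.
apply/card_gt0P; exists (~: [set i]).
by rewrite !inE eqxx /= max_setC // max_no_singleton cardsC1 card_ord eqxx.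
Qed.

(* [gain t] is the contribution of the pair of levels [t], [n - t] to the
   defect [3 ^ n.-1 - mass M]. *)
Let gain i (t : nat) : int :=
  (((level i t)%:Z - (level i (n - t)%N)%:Z) * ((2 ^ t)%N%:Z - (2 ^ (n - t))%N%:Z))%R.

(** By [level_compl] and the monotonicity of powers, the two factors of [gain] never have opposite
    signs. *)
Let gain_ge0 i t : t <= n -> (0 <= gain i t)%R.
Proof.
move=> tn; rewrite /gain; have [t2|t2] := leqP t.*2 n.
  have := level_compl i t2.
  have : 2 ^ t <= 2 ^ (n - t) by rewrite leq_exp2l //; lia.
  nia.
have := @level_compl i (n - t) ltac:(lia); rewrite subKn //.
have : 2 ^ (n - t) <= 2 ^ t by rewrite leq_exp2l //; lia.
nia.
Qed.

Let gain_sym i t : t <= n -> gain i (n - t) = gain i t.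
Proof. by move=> tn; rewrite /gain subKn // -mulrNN !opprB. Qed.

Let mass_gain i :
  (((3 ^ n.-1)%N%:Z - (mass M)%:Z) *+ 2 = \sum_(t < n.+1) gain i t)%R.
Proof.
have := mass_level i.
set a := \sum_(t < n.+1) _; set b := \sum_(t < n.+1) _ => E.
have -> : ((3 ^ n.-1)%N%:Z - (mass M)%:Z = a%:Z - b%:Z)%R by lia.
have D : (a%:Z - b%:Z =
    \sum_(t < n.+1) (level i t)%:Z * ((2 ^ t)%N%:Z - (2 ^ (n - t))%N%:Z))%R.
  rewrite -!natz !natr_sum -sumrB; apply: eq_bigr => t _.
  by rewrite -!natz !natrM; ring.
(* Reversing [t] to [n - t] gives a second expression for the same difference; the two add up to the
   gains, whence the doubled defect. *)
have D' : (a%:Z - b%:Z =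
    \sum_(t < n.+1) (level i (n - t)%N)%:Z * ((2 ^ (n - t))%N%:Z - (2 ^ t)%N%:Z))%R.
  rewrite D (reindex_inj rev_ord_inj) /=; apply: eq_bigr => t _.
  by rewrite subSS subKn // -ltnS.
rewrite mulr2n {1}D D' -big_split /=; apply: eq_bigr => t _; rewrite /gain; ring.
Qed.

Let sum_gain_ge (I : {set 'I_n.+1}) i :
  (\sum_(t in I) gain i t <= ((3 ^ n.-1)%N%:Z - (mass M)%:Z) *+ 2)%R.
Proof.
rewrite (mass_gain i) [leRHS](bigID (mem I)) /= lerDl sumr_ge0 // => t _.
by apply: gain_ge0; rewrite -ltnS.
Qed.

Let gain_predn i : 3 <= n -> ((2 ^ n.-1)%N%:Z - 2 <= gain i n.-1)%R.
Proof.
move=> n3; rewrite /gain; have -> : n - n.-1 = 1 by lia.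
rewrite level1; have := level_predn i.
have : 2 ^ 1 <= 2 ^ n.-1 by rewrite leq_exp2l //; lia.
nia.
Qed.

(** The equal gains at [1] and [n - 1] alone force a defect of at least [2 ^ (n - 1) - 2]. *)
Lemma mass_max : 3 <= n -> mass M <= Mstar n.
Proof.
move=> n3; have i : 'I_n by exists 0; lia.
have o1 : 1 < n.+1 by lia.
have o2 : n.-1 < n.+1 by lia.
have := sum_gain_ge [set Ordinal o1; Ordinal o2] i.
rewrite big_setU1 ?inE -?val_eqE /= ?big_set1 /=; last by lia.
have -> : gain i 1 = gain i n.-1 by rewrite -gain_sym ?subn1 //; lia.
have := gain_predn i n3; rewrite /Mstar.
have : 2 ^ n.-1 <= 3 ^ n.-1 by rewrite leq_exp2r //; lia.
lia.
Qed.

(** Levels [2] and [n - 2] add at least [2 ^ (n - 2) - 4] to the defect; [5 <= n] keeps the four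
    levels distinct. *)
Lemma mass_max_level i : 5 <= n -> level i 2 < level i (n - 2) ->
  mass M + 2 ^ (n - 2) <= Mstar n + 4.
Proof.
move=> n5 lt2.
have o1 : 1 < n.+1 by lia.
have o2 : n.-1 < n.+1 by lia.
have o3 : 2 < n.+1 by lia.
have o4 : n - 2 < n.+1 by lia.
have := sum_gain_ge [set Ordinal o1; Ordinal o2; Ordinal o3; Ordinal o4] i.
rewrite -!setUA !big_setU1 ?inE -?val_eqE /= ?big_set1 /=; try lia.
have -> : gain i 1 = gain i n.-1 by rewrite -gain_sym ?subn1 //; lia.
have <- : gain i (n - 2) = gain i 2 by rewrite gain_sym //; lia.
have := gain_predn i (ltac:(lia) : 3 <= n); rewrite /Mstar.
have : 2 ^ n.-1 <= 3 ^ n.-1 by rewrite leq_exp2r //; lia.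
have : ((2 ^ (n - 2))%N%:Z - 4 <= gain i (n - 2))%R.
  rewrite /gain subKn; last by lia.
  have : 2 ^ 2 <= 2 ^ (n - 2) by rewrite leq_exp2l //; lia.
  nia.
lia.
Qed.

Lemma card_nonedges_le_level i :
  #|[set j | (j != i) && ([set i; j] \notin M)]| <= level i (n - 2).
Proof.
have n_gt0 : 0 < n by case: i => k /=; lia.
rewrite /level -(card_in_imset (f := fun j => ~: [set i; j])); last first.
  move=> j k; rewrite !inE => /andP[ji _] /andP[ki _] /(congr1 (fun X => j \in X)).
  by rewrite !inE eqxx orbT (negbTE ji) /= => /esym/negbFE/eqP.
apply/subset_leq_card/subsetP => _ /imsetP[j + ->]; rewrite !inE => /andP[ji ijM].
by rewrite max_setC // ijM eqxx /= cardsCs setCK card_ord cards2 [i == j]eq_sym ji /= eqxx.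
Qed.

(* The two-element members form a triangle or part of a star. *)
Lemma full_star_or_level : 5 <= n ->
  (exists a, forall j, j != a -> [set a; j] \in M) \/
  (exists i, level i 2 < level i (n - 2)).
Proof.
move=> n5.
have [/existsP[x /existsP[y /andP[xy xyM]]]|no_edge] :=
  boolP [exists x, exists y, (x != y) && ([set x; y] \in M)]; last first.
  have noE x y : x != y -> [set x; y] \notin M.
    move=> xy; apply: contraNN no_edge => xyM.
    by apply/existsP; exists x; apply/existsP; exists y; rewrite xy.
  have n_gt0 : 0 < n by lia.
  have n_gt1 : 1 < n by lia.
  pose i := Ordinal n_gt0; right; exists i.
  apply: leq_trans (card_nonedges_le_level i).
  have -> : level i 2 = 0.
    apply: eq_card0 => T; rewrite !inE; apply/negP => /and3P[TM _ /cards2P[u [v [uv Tuv]]]].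
    by move: TM; rewrite Tuv (negbTE (noE _ _ uv)).
  by apply/card_gt0P; exists (Ordinal n_gt1); rewrite !inE noE.
(* With the two-element members as edges, [P] holds the non-neighbours of [x] and [Q] the neighbours
   of [y] other than [x]. An edge avoiding [x] must pass through [y], so [level x 2 <= #|Q|],
   whereas [#|P| <= level x (n - 2)]. *)
pose P := [set j | (j != x) && ([set x; j] \notin M)].
pose Q := [set z | [&& z != x, z != y & [set y; z] \in M]].
have levQ : level x 2 <= #|Q|.
  apply: leq_trans (leq_imset_card (fun z => [set y; z]) (mem Q)).
  apply/subset_leq_card/subsetP => T; rewrite !inE => /and3P[TM xT T2].
  have yT : y \in T.
    have /set0Pn[u] := max_meet xyM TM; rewrite !inE => /andP[/orP[]/eqP -> //].
    by rewrite (negbTE xT).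
  have /cards1P[z Tz] : #|T :\ y| == 1 by move: T2; rewrite (cardsD1 y) yT.
  have : z \in T :\ y by rewrite Tz set11.
  rewrite !inE => /andP[zy zT].
  have ET : T = [set y; z] by rewrite -(setD1K yT) Tz.
  apply/imsetP; exists z => //; rewrite !inE zy -ET TM !andbT.
  by apply: contraNneq xT => <-.
have Ply : P \subset ~: [set x; y].
  apply/subsetP => j; rewrite !inE => /andP[jx xjM]; rewrite negb_or jx /=.
  by apply: contraNneq xjM => ->.
have Qly : Q \subset ~: [set x; y].
  by apply/subsetP => j; rewrite !inE negb_or => /and3P[-> ->].
have card2 : #|~: [set x; y]| = n - 2 by rewrite cardsCs setCK card_ord cards2 xy.
have meet_xy j z : j != x -> j != y -> z != x -> z != y ->
    [set x; j] \in M -> [set y; z] \in M -> j = z.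
  move=> jx jy zx zy xjM yzM; have /set0Pn[u] := max_meet xjM yzM.
  rewrite !inE => /andP[/orP[]/eqP -> /orP[]]; rewrite ?(negbTE xy) ?(negbTE jy) // => /eqP E //.
  by move: zx; rewrite E eqxx.
suff [Pfull|[Qfull|ltQP]] : P = set0 \/ Q = ~: [set x; y] \/ #|Q| < #|P|.
- left; exists x => j jx; apply: contraT => xjM.
  by have := in_set0 j; rewrite -Pfull inE jx xjM.
- left; exists y => j jy; have [->|jx] := eqVneq j x; first by rewrite setUC.
  have : j \in Q by rewrite Qfull !inE negb_or jx jy.
  by rewrite inE => /and3P[].
- right; exists x; apply: leq_ltn_trans levQ _.
  exact: leq_trans ltQP (card_nonedges_le_level x).
have [->|/set0Pn[p pP]] := eqVneq P set0; first by left.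
have [->|/set0Pn[q qQ]] := eqVneq Q set0.
  by right; right; rewrite cards0; apply/card_gt0P; exists p.
right; move: (qQ); rewrite inE => /and3P[qx qy yqM].
have sP : ~: [set x; y; q] \subset P.
  apply/subsetP => j; rewrite !inE !negb_or => /andP[/andP[jx jy] jq].
  by rewrite jx /=; apply: contraNN jq => xjM; apply/eqP/meet_xy.
have [qP|qP] := boolP (q \in P).
  have PE : P = ~: [set x; y].
    apply/eqP; rewrite eqEsubset Ply; apply/subsetP => j.
    rewrite !inE negb_or => /andP[jx jy].
    have [->|jq] := eqVneq j q; first by move: qP; rewrite inE.
    by have /(subsetP sP) : j \in ~: [set x; y; q]; rewrite !inE ?negb_or ?jx ?jy.
  have [->|QF] := eqVneq Q (~: [set x; y]); first by left.
  by right; rewrite PE; apply: proper_card; rewrite properEneq QF.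
(* Now [x], [y], [q] form a triangle: [Q] is just [q], while [P] has at least [n - 3] points. *)
right; have xqM : [set x; q] \in M.
  by move: qP; rewrite inE qx /= negbK.
have : #|Q| <= 1.
  rewrite -(cards1 q); apply/subset_leq_card/subsetP => z; rewrite !inE => /and3P[zx zy yzM].
  by rewrite (meet_xy q z).
move/leq_ltn_trans; apply; apply: leq_trans (subset_leq_card sP).
by rewrite cardsCs setCK card_ord setUC cardsU1 cards2 xy !inE negb_or qx qy /= ltn_subRL (leq_trans _ n5).
Qed.

(** A member avoiding [a] meets every [[set a; j]] in [j], so it is the complement of [a]. *)
Lemma full_star_sub_HM a : (forall j, j != a -> [set a; j] \in M) ->
  M \subset ~: [set a] |: (star [set a] :\ [set a]).
Proof.
move=> edges; apply/subsetP => S SM; rewrite !inE sub1set.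
have [aS|aS] := boolP (a \in S).
  rewrite andbT; apply/orP; right.
  by apply: contraTneq SM => ->; exact: max_no_singleton.
rewrite andbF orbF; apply/eqP/setP => j; rewrite !inE.
have [->|ja] := eqVneq j a; first exact: negbTE.
have /set0Pn[u] := max_meet (edges _ ja) SM.
by rewrite !inE => /andP[/orP[]/eqP -> //]; rewrite (negbTE aS).
Qed.
End MaximalFamilies.

(** * Sums over non-trivial families *)

Section NontrivialSums.
Variable n : nat.
Implicit Types (S T : {set 'I_n}) (F M : {set {set 'I_n}}) (a i j : 'I_n).

Lemma nontrivial_extends F : intersecting F -> ~~ trivial_family F ->
  exists2 M, maximal_nontrivial M & F \subset M.
Proof.
move=> Fint Fnt; have [M maxM FM] := maxset_exists Fint.
by exists M => //; rewrite /maximal_nontrivial maxM; apply: contraNN Fnt; exact: trivialS.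
Qed.

Lemma Rnt_le_lambda : 3 <= n -> Rnt n <= lambda n * 2 ^ Mstar n.
Proof.
move=> n3.
apply: (@leq_trans (\sum_(M in [set M : {set {set 'I_n}} | maximal_nontrivial M])
    \sum_(F : {set {set 'I_n}} | F \subset M) family_weight F)); last first.
  rewrite /lambda -sum_nat_const; apply: leq_sum => M; rewrite inE => /andP[maxM ntM].
  by rewrite sum_family_weight leq_exp2l //; exact: mass_max.
under [leqRHS]eq_bigr do rewrite big_mkcond /=.
rewrite exchange_big /= /Rnt [leqLHS]big_mkcond /=.
apply: leq_sum => F _; case: ifP => // /andP[Fint Fnt].
have [M MM FM] := nontrivial_extends Fint Fnt.
by rewrite (bigD1 M) ?inE //= FM leq_addr.
Qed.

Definition HM_core a : {set {set 'I_n}} := star [set a] :\ [set a].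
(** The Hilton-Milner family with centre [a]: a set containing [a] meets [~: [set a]] unless it is
    [[set a]]. *)
Definition HM a : {set {set 'I_n}} := ~: [set a] |: HM_core a.

Lemma mass_HM_core a : mass (HM_core a) = 3 ^ n.-1 - 2 ^ n.-1.
Proof.
have := mass_star [set a]; rewrite cards1 subn1 => <-.
rewrite {2}/mass (big_setD1 [set a]) /=; last by rewrite inE.
by rewrite cards1 subn1 addKn.
Qed.

Lemma mass_setU1 S F : mass (S |: F) <= 2 ^ (n - #|S|) + mass F.
Proof.
have [SF|SF] := boolP (S \in F); last by rewrite /mass big_setU1.
by rewrite (setUidPr _) ?sub1set // leq_addl.
Qed.

Lemma card_coatom a : n - #|~: [set a]| = 1.
Proof. by rewrite cardsC1 card_ord; have := ltn_ord a; lia. Qed.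

Lemma mem_HM a S : (S \in HM a) = (S == ~: [set a]) || ((a \in S) && (S != [set a])).
Proof. by rewrite !inE sub1set andbC. Qed.

(** The complement of [a] has mass [2], so the subfamilies omitting it carry one quarter of the
    total weight [2 ^ mass (HM a)]. *)
Lemma sum_HM a :
  \sum_(F : {set {set 'I_n}} | (F \subset HM a) && (~: [set a] \in F)) family_weight F
  = 3 * 2 ^ mass (HM_core a).
Proof.
have BHM : ~: [set a] \notin HM_core a by rewrite !inE sub1set !inE eqxx andbF.
have := sum_family_weight (HM a).
rewrite (bigID (fun F : {set {set 'I_n}} => ~: [set a] \in F)) /=.
rewrite [X in _ + X](_ : _ = 2 ^ mass (HM_core a)); last first.
  rewrite -sum_family_weight; apply: eq_bigl => F.
  apply/andP/idP => [[/subsetP FH BF]|/subsetP FH].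
    apply/subsetP => S SF; have := FH S SF; rewrite in_setU1 => /predU1P[E|//].
    by rewrite -E SF in BF.
  split; first by apply/subsetP => S /FH SF; rewrite in_setU1 SF orbT.
  by apply: contraNN BHM => /FH.
have -> : mass (HM a) = 2 + mass (HM_core a).
  by rewrite {1}/mass big_setU1 //= card_coatom.
rewrite expnD; lia.
Qed.

Lemma HM_nontrivial_mem a F : F \subset HM a -> ~~ trivial_family F -> ~: [set a] \in F.
Proof.
move=> /subsetP FH; apply: contraNT => BF; apply/trivialP; exists a.
apply/subsetP => S SF; have := FH S SF; rewrite mem_HM inE sub1set.
by case/orP => [/eqP E|/andP[]//]; rewrite -E SF in BF.
Qed.

(** A non-trivial family lies in some [HM a] and contains its [~: [set a]], or lies in a maximal
    family whose mass is at least [2 ^ (n - 2) - 4] below [Mstar n]. The latter are counted crudely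
    by [lambda n]. *)
Lemma Rnt_le_HM : 5 <= n ->
  Rnt n <= n * (3 * 2 ^ (3 ^ n.-1 - 2 ^ n.-1)) +
           lambda n * 2 ^ (Mstar n + 4 - 2 ^ (n - 2)).
Proof.
move=> n5.
pose small M := maximal_nontrivial M && (mass M + 2 ^ (n - 2) <= Mstar n + 4).
pose isHM a F := (F \subset HM a) && (~: [set a] \in F).
have dich F : intersecting F -> ~~ trivial_family F ->
    (exists a, isHM a F) \/ (exists2 M, small M & F \subset M).
  move=> Fint Fnt; have [M /[dup] MM /andP[maxM ntM] FM] := nontrivial_extends Fint Fnt.
  have [[a Ha]|[i Hi]] := full_star_or_level maxM ntM n5; [left|right].
    have FH : F \subset HM a := subset_trans FM (full_star_sub_HM maxM ntM Ha).
    by exists a; rewrite /isHM FH (HM_nontrivial_mem FH).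
  by exists M; rewrite // /small MM (mass_max_level maxM ntM n5 Hi).
apply: (@leq_trans (\sum_a \sum_(F : {set {set 'I_n}} | isHM a F) family_weight F +
   \sum_(M in [set M : {set {set 'I_n}} | small M])
     \sum_(F : {set {set 'I_n}} | F \subset M) family_weight F)).
  under eq_bigr do rewrite big_mkcond /=.
  under [X in _ <= _ + X]eq_bigr do rewrite big_mkcond /=.
  rewrite exchange_big /= [X in _ <= _ + X]exchange_big /= -big_split /=.
  rewrite /Rnt [leqLHS]big_mkcond /=.
  apply: leq_sum => F _; case: ifP => // /andP[Fint Fnt].
  have [[a Ha]|[M Msm FM]] := dich F Fint Fnt.
    by rewrite (bigD1 a) //= Ha -addnA leq_addr.
  by rewrite [X in _ + X](bigD1 M) ?inE //= FM addnCA leq_addr.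
apply: leq_add.
  rewrite -[X in _ <= X * _](card_ord n) -sum_nat_const; apply: leq_sum => a _.
  by rewrite sum_HM mass_HM_core.
apply: (@leq_trans (#|[set M : {set {set 'I_n}} | small M]| *
  2 ^ (Mstar n + 4 - 2 ^ (n - 2)))).
  rewrite -sum_nat_const; apply: leq_sum => M; rewrite inE => /andP[_ Ms].
  by rewrite sum_family_weight leq_exp2l //; lia.
rewrite leq_mul2r /lambda; apply/orP; right; apply/subset_leq_card/subsetP => M.
by rewrite !inE => /andP[].
Qed.

Lemma HM_sub_intersecting a F : 2 <= n -> F \subset HM a -> intersecting F.
Proof.
move=> n2 /subsetP FH.
have key S : a \in S -> S != [set a] -> S :&: ~: [set a] != set0.
  move=> aS; apply: contraNneq => S0.
  by rewrite eqEsubset sub1set aS andbT -setD_eq0 setDE S0 eqxx.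
apply/intersectingP; split=> [S SF|S T SF TF].
  have := FH S SF; rewrite mem_HM => /orP[/eqP ->|/andP[aS _]]; last by apply/set0Pn; exists a.
  by rewrite -card_gt0 cardsCs setCK cards1 card_ord; lia.
have := FH S SF; have := FH T TF; rewrite !mem_HM.
case/orP => [/eqP ->|/andP[aT Ta]] /orP[/eqP ->|/andP[aS Sa]].
- by rewrite setIid -card_gt0 cardsCs setCK cards1 card_ord; lia.
- exact: key.
- by rewrite setIC; exact: key.
- by apply/set0Pn; exists a; rewrite inE aS.
Qed.

(* Families counted once below must avoid these, which are trivial or shared
   by two Hilton-Milner families. *)
Definition HM_overlap a j : {set {set 'I_n}} :=
  ~: [set a] |: (~: [set j] |: star [set a; j]).

(** Subfamilies of [HM a] that contain [~: [set a]] and lie in no [HM_overlap a j] are non-trivial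
    and have a single centre, so summing over [a] counts each once. *)
Lemma Rnt_ge_HM : 2 <= n ->
  n * (3 * 2 ^ (3 ^ n.-1 - 2 ^ n.-1)) <=
  Rnt n + n * (n * 2 ^ (3 ^ (n - 2) + 4)).
Proof.
move=> n2.
pose isHM a F := (F \subset HM a) && (~: [set a] \in F).
pose good a F := isHM a F && [forall (j | j != a), ~~ (F \subset HM_overlap a j)].
apply: (@leq_trans (\sum_a (\sum_(F : {set {set 'I_n}} | good a F) family_weight F +
    n * 2 ^ (3 ^ (n - 2) + 4)))).
  rewrite -[X in X * _ <= _](card_ord n) -sum_nat_const; apply: leq_sum => a _.
  rewrite -(mass_HM_core a) -sum_HM.
  apply: (@leq_trans (\sum_(F : {set {set 'I_n}} | good a F) family_weight F +
     \sum_(j | j != a) \sum_(F : {set {set 'I_n}} | F \subset HM_overlap a j) family_weight F)).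
    under [X in _ <= _ + X]eq_bigr do rewrite big_mkcond /=.
    rewrite [X in _ <= _ + X]exchange_big /= [X in _ <= X + _]big_mkcond /= -big_split /=.
    rewrite [leqLHS]big_mkcond /=; apply: leq_sum => F _; rewrite /good /isHM.
    case: ifP => //= HF; case: ifP => [_|/negbT]; first exact: leq_addr.
    rewrite negb_forall => /existsP[j]; rewrite negb_imply negbK => /andP[ja Fj].
    by rewrite (bigD1 j) //= Fj addnCA leq_addr.
  (* The star of two points has mass [3 ^ (n - 2)], and each of the two complements adds at most
     [2]. *)
  rewrite leq_add2l; apply: (@leq_trans (\sum_(j : 'I_n | j != a) 2 ^ (3 ^ (n - 2) + 4))).
    apply: leq_sum => j ja; rewrite sum_family_weight leq_exp2l // /HM_overlap.
    apply: leq_trans (mass_setU1 _ _) _; rewrite card_coatom.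
    have := mass_setU1 (~: [set j]) (star [set a; j]); rewrite card_coatom mass_star.
    rewrite cards2 [a == j]eq_sym ja /= !expn1 -(leq_add2l 2).
    by move=> /leq_trans; apply; rewrite addnA addnC.
  rewrite sum_nat_cond_const leq_mul2r; apply/orP; right.
  by rewrite -[leqRHS](card_ord n) max_card.
rewrite big_split /= sum_nat_const card_ord leq_add2r.
under eq_bigr do rewrite big_mkcond /=.
rewrite exchange_big /= /Rnt [leqRHS]big_mkcond /=; apply: leq_sum => F _.
have [a Ha|none] := pickP (fun a => good a F); last first.
  by rewrite big1 // => a _; rewrite none.
rewrite (bigD1 a) //= Ha big1 ?addn0; last first.
  (* A common member of [HM a] and [HM b] contains both points or is one of the two complements, so
     [F] would lie in [HM_overlap a b]. *)
  move=> b ba; case: ifP => // /andP[/andP[/subsetP Hb _] _].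
  case/andP: Ha => /andP[/subsetP Ha _] /forall_inP notov.
  case/negP: (notov b ba); apply/subsetP => S SF.
  have := Ha S SF; have := Hb S SF; rewrite !mem_HM /HM_overlap !inE.
  rewrite subUset !sub1set.
  case/orP => [->|/andP[-> _]]; rewrite ?orbT //.
  by case/orP => [->|/andP[-> _]]; rewrite ?orbT.
case/andP: Ha => /andP[FH BF] /forall_inP notov.
rewrite (HM_sub_intersecting n2 FH) /=; case: ifPn => //; rewrite negbK => /trivialP[j Fj].
have [ja|ja] := eqVneq j a.
  by move/subsetP: Fj => /(_ _ BF); rewrite ja !inE sub1set !inE eqxx.
case/negP: (notov j ja); apply/subsetP => S SF.
have := subsetP FH S SF; have := subsetP Fj S SF.
rewrite mem_HM !inE subUset !sub1set => ->.
by case/orP => [->//|/andP[-> _]]; rewrite !orbT.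
Qed.
End NontrivialSums.

(** * Hansel's bound *)

Section Hansel.
Variables (T : finType) (C : eqType) (len : C -> nat) (chain : {set T} -> C).
Variable mid : {set {set T}}.
Implicit Types (X Y Z V : {set T}) (F G H : {set {set T}}).

Hypothesis chain_total : forall X Y : {set T},
  chain X = chain Y -> (X \subset Y) || (Y \subset X).
(** Hansel's condition on the chains: between two non-adjacent elements of a chain lies an element
    of a shorter chain. *)
Hypothesis chain_between : forall X Y Z : {set T},
  chain Y = chain X -> chain Z = chain X -> X \proper Y -> Y \proper Z ->
  exists2 V : {set T}, len (chain V) < len (chain X) & (X \subset V) && (V \subset Z).
Hypothesis chain_mid : forall X : {set T}, exists2 Y, Y \in mid & chain Y = chain X.

Definition up_closed F :=
  [forall X in F, forall Y : {set T}, (X \subset Y) ==> (Y \in F)].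

Lemma up_closedP F : up_closed F -> forall X Y, X \in F -> X \subset Y -> Y \in F.
Proof. by move=> /forall_inP H X Y /H /forallP /(_ Y) /implyP. Qed.

Definition agree_below k F G :=
  [forall X : {set T}, (len (chain X) < k) ==> ((X \in F) == (X \in G))].

Lemma agree_belowP k F G :
  reflect (forall X, len (chain X) < k -> (X \in F) = (X \in G)) (agree_below k F G).
Proof. by apply: (iffP 'forall_implyP) => H X /H /eqP. Qed.

(** For up-closed [F]: its values on the shorter chains do not settle whether [X] belongs to it. *)
Definition undetermined F X := [exists G : {set {set T}},
  [&& up_closed G, agree_below (len (chain X)) F G & (X \in G) != (X \in F)]].

Definition undet_on F X :=
  [set Y : {set T} | (chain Y == chain X) && undetermined F Y].

(** Given three undetermined elements on a chain, some [V] on a shorter chain lies between the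
    least, [A], and the greatest, [B]. If [V] is in [F] then [B] is forced in; otherwise [A] is
    forced out. *)
Lemma undet_on_le2 F X : up_closed F -> #|undet_on F X| <= 2.
Proof.
move=> upF; rewrite leqNgt; apply/negP => gt2.
have /card_gt0P[A0 A0U] : 0 < #|undet_on F X| by lia.
case: (@arg_minnP _ A0 (mem (undet_on F X)) (fun Y => #|Y|) A0U) => A AU Amin.
case: (@arg_maxnP _ A0 (mem (undet_on F X)) (fun Y => #|Y|) A0U) => B BU Bmax.
have /card_gt0P[Y] : 0 < #|undet_on F X :\ A :\ B|.
  by move: (cardsD1 A (undet_on F X)) (cardsD1 B (undet_on F X :\ A)); lia.
rewrite !in_setD1 => /and3P[YB YA YU].
have chE Z : Z \in undet_on F X -> chain Z = chain X /\ undetermined F Z.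
  by rewrite inE => /andP[/eqP].
have [Ac Au] := chE A AU; have [Bc Bu] := chE B BU; have [Yc _] := chE Y YU.
have AY : A \proper Y.
  rewrite properEneq eq_sym YA /=.
  have /orP[//|YA'] := @chain_total A Y (etrans Ac (esym Yc)).
  by have /eqP -> // : A == Y; rewrite eq_sym eqEcard YA' /=; exact: Amin.
have YB' : Y \proper B.
  rewrite properEneq YB /=.
  have /orP[//|YA'] := @chain_total Y B (etrans Yc (esym Bc)).
  by have /eqP -> // : Y == B; rewrite eq_sym eqEcard YA' /=; exact: Bmax.
have [V Vlen /andP[AV VB]] := chain_between (etrans Yc (esym Ac)) (etrans Bc (esym Ac)) AY YB'.
have agV G Z : chain Z = chain X -> agree_below (len (chain Z)) F G -> (V \in F) = (V \in G).
  by move=> Zc /agree_belowP; apply; rewrite Zc -Ac.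
have [VF|VF] := boolP (V \in F).
  case/existsP: Bu => G /and3P[upG agG] /negP[].
  by rewrite (up_closedP upF VF VB) (up_closedP upG _ VB) // -(agV _ _ Bc agG).
case/existsP: Au => G /and3P[upG agG] /negP[].
have nA H : up_closed H -> V \notin H -> (A \in H) = false.
  by move=> upH; apply: contraNF => AH; exact: up_closedP upH _ _ AH AV.
by rewrite !nA // -(agV _ _ Ac agG).
Qed.

(** Being undetermined depends on the shorter chains only; if [F] and [G] differ at [X], then [F]
    itself is the witness for [G]. *)
Lemma undeterminedS F G X : up_closed F -> agree_below (len (chain X)) F G ->
  undetermined F X -> undetermined G X.
Proof.
move=> upF /agree_belowP agFG /existsP[H /and3P[upH /agree_belowP agFH XHF]]; apply/existsP.
have [XFG|XFG] := eqVneq (X \in F) (X \in G).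
  by exists H; rewrite upH -XFG XHF andbT; apply/agree_belowP => Y Yl; rewrite -agFG ?agFH.
by exists F; rewrite upF XFG andbT; apply/agree_belowP => Y Yl; rewrite agFG.
Qed.

(** An up-closed family meets a chain in an upper segment, so the number of undetermined elements in
    it tells which ones they are. *)
Lemma same_count_sub F G X : up_closed F -> up_closed G ->
  agree_below (len (chain X)) F G ->
  #|undet_on F X :&: F| = #|undet_on G X :&: G| -> X \in F -> X \in G.
Proof.
move=> upF upG agFG; have agGF : agree_below (len (chain X)) G F.
  by apply/agree_belowP => Y Yl; rewrite (agree_belowP _ _ _ agFG).
have -> : undet_on G X = undet_on F X.
  apply/setP => Y; rewrite !inE; apply: andb_id2l => /eqP Yc.
  by apply/idP/idP; apply: undeterminedS; rewrite ?Yc.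
move=> eqc XF; apply: contraT => XG.
have Xu : undetermined F X by apply/existsP; exists G; rewrite upG agFG XF (negbTE XG).
suff /proper_card : undet_on F X :&: G \proper undet_on F X :&: F by rewrite eqc ltnn.
apply/properP; split; last by exists X; rewrite !inE eqxx Xu ?(negbTE XG) ?XF.
apply/subsetP => Y; rewrite !inE => /andP[/andP[/eqP Yc ->] YG].
rewrite Yc eqxx /=; have /orP[YX|] := chain_total Yc; last exact: up_closedP.
by rewrite (up_closedP upG YG YX) in XG.
Qed.

(* Hansel's argument: with the chains in order of increasing length, each one leaves
   at most two undetermined elements, hence at most three possibilities. *)
Lemma card_up_closed : #|[set F | up_closed F]| <= 3 ^ #|mid|.
Proof.
(* One digit among [0], [1], [2] per middle set: how many undetermined elements of its chain lie in
   [F]. *)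
pose code F : {ffun {Y : {set T} | Y \in mid} -> 'I_3} :=
  [ffun m => inord #|undet_on F (val m) :&: F|].
have codeE F m : up_closed F -> code F m = #|undet_on F (val m) :&: F| :> nat.
  move=> upF; rewrite ffunE inordK // ltnS; apply: leq_trans (undet_on_le2 (val m) upF).
  by apply: subset_leq_card; rewrite subsetIl.
rewrite -(card_in_imset (f := code)).
  apply: leq_trans (max_card _) _.
  by rewrite card_ffun card_ord card_sig.
move=> F G; rewrite !inE => upF upG FG.
suff H k : agree_below k F G.
  by apply/setP => X; exact: (agree_belowP _ _ _ (H (len (chain X)).+1)).
elim: k => [|k IH]; apply/agree_belowP => // X; rewrite ltnS leq_eqVlt.
case/orP => [/eqP Xk|]; last exact: (agree_belowP _ _ _ IH).
have [m mM mX] := chain_mid X.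
have := congr1 (fun f : {ffun _ -> 'I_3} => f (Sub m mM) : nat) FG.
rewrite !codeE // SubK /undet_on mX => cnt.
have agFG : agree_below (len (chain X)) F G by rewrite Xk.
have agGF : agree_below (len (chain X)) G F.
  by apply/agree_belowP => Y Yl; rewrite (agree_belowP _ _ _ agFG).
by apply/idP/idP; apply: same_count_sub.
Qed.
End Hansel.

(** * Symmetric chains *)

(* De Bruijn-Tengbergen-Kruyswijk chains, coded by words: the chain
   x_0 < ... < x_(k-1) with code [c] yields 0x_0 < ... < 0x_(k-1) < 1x_(k-1) with code
   [true :: c] and 1x_0 < ... < 1x_(k-2) with code [false :: c]. *)
Fixpoint chain_size (c : seq bool) : nat :=
  if c is b :: c' then if b then (chain_size c').+1 else (chain_size c').-1 else 1.

Fixpoint chain_pos (x : seq bool) : seq bool * nat :=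
  if x is b :: x' then
    let: (c, p) := chain_pos x' in
    if b then if p.+1 == chain_size c then (true :: c, p.+1) else (false :: c, p)
    else (true :: c, p)
  else ([::], 0).

Definition word_le (x y : seq bool) := all2 implb x y.

Lemma word_le_refl x : word_le x x.
Proof. by elim: x => [|[] x IH]. Qed.

Lemma size_chain x : size (chain_pos x).1 = size x.
Proof.
elim: x => [|b x IH] //=; case: (chain_pos x) IH => c p /= IH.
by case: b; [case: ifP|]; rewrite /= IH.
Qed.

Lemma chain_pos_lt x c p : chain_pos x = (c, p) -> p < chain_size c.
Proof.
elim: x c p => [|b x IH] c p /=; first by case=> <- <-.
case: (chain_pos x) IH => c' p' /(_ c' p' erefl) lt'.
by case: b; [case: ifP|] => [/eqP e|/eqP e|] [<- <-] /=; lia.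
Qed.

(** Symmetry: for words of length [n], a chain of size [k] occupies the ranks from [(n + 1 - k) / 2]
    to [(n - 1 + k) / 2]. *)
Lemma chain_pos_rank x c p : chain_pos x = (c, p) ->
  (count id x).*2 + chain_size c = size x + 1 + p.*2.
Proof.
elim: x c p => [|b x IH] c p /=; first by case=> <- <-.
case E: (chain_pos x) => [c' p']; have := IH _ _ E; have := chain_pos_lt E.
by case: b; [case: ifP|] => [/eqP e|/eqP e|] lt' IH' [<- <-] /=; rewrite -?subn1; lia.
Qed.

Lemma chain_pos_nilP x p : chain_pos x = ([::], p) -> x = [::].
Proof. by move=> E; apply/nilP; rewrite /nilp -size_chain E. Qed.

Lemma chain_pos_trueP x c q : chain_pos x = (true :: c, q) ->
  (exists2 y, x = false :: y & chain_pos y = (c, q)) \/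
  (exists2 y, x = true :: y &
    exists2 p, chain_pos y = (c, p) & q = p.+1 /\ p.+1 = chain_size c).
Proof.
case: x => [|b x] //=; case E: (chain_pos x) => [c' p'].
case: b => [|[<- <-]]; last by left; exists x.
by case: ifP => // /eqP e [<- <-]; right; exists x => //; exists p'.
Qed.

Lemma chain_pos_falseP x c q : chain_pos x = (false :: c, q) ->
  exists2 y, x = true :: y & chain_pos y = (c, q) /\ q.+1 < chain_size c.
Proof.
case: x => [|b x] //=; case E: (chain_pos x) => [c' p']; have lt' := chain_pos_lt E.
case: b => //; case: ifP => // /eqP e [<- <-]; exists x => //; split=> //; lia.
Qed.

Lemma chain_pos_le x y c p q : chain_pos x = (c, p) -> chain_pos y = (c, q) ->
  p <= q -> word_le x y.
Proof.
elim: c x y p q => [|[] c IH] x y p q.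
- by move=> /chain_pos_nilP ex /chain_pos_nilP ey _; rewrite ex ey.
- move=> /chain_pos_trueP[[x' -> Ex]|[x' -> [p' Ex [-> e]]]]
         /chain_pos_trueP[[y' -> Ey]|[y' -> [q' Ey [-> e']]]] pq;
    rewrite /= ?(IH _ _ _ _ Ex Ey) //.
    by have := chain_pos_lt Ex; lia.
  by have := chain_pos_lt Ey; lia.
- move=> /chain_pos_falseP[x' -> [Ex _]] /chain_pos_falseP[y' -> [Ey _]] pq.
  by rewrite /= (IH _ _ _ _ Ex Ey).
Qed.

(** The bound on [count] serves the induction: for a code starting with [false], prefixing [w] by
    [true] may lengthen its chain, and by [chain_pos_rank] this bound keeps that chain short
    enough. *)
Lemma chain_pos_between x y z c p q r :
  chain_pos x = (c, p) -> chain_pos y = (c, q) -> chain_pos z = (c, r) -> p < q < r ->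
  exists w, [/\ size w = size x, chain_size (chain_pos w).1 < chain_size c,
    word_le x w, word_le w z & count id w < count id z].
Proof.
elim: c x y z p q r => [|[] c IH] x y z p q r.
- by move=> /chain_pos_lt /=; move=> ? /chain_pos_lt /=; lia.
- move=> /chain_pos_trueP[[x' -> Ex]|[x' -> [p' Ex [-> e]]]]; last first.
    by move=> /chain_pos_lt /=; lia.
  move=> /chain_pos_trueP[[y' _ Ey]|[y' _ [q' Ey [-> e]]]]; last first.
    by move=> /chain_pos_lt /=; lia.
  move=> /chain_pos_trueP[[z' -> Ez]|[z' -> [r' Ez [-> e]]]] pqr.
    have [w [ws wl xw wz wc]] := IH _ _ _ _ _ _ Ex Ey Ez pqr.
    exists (false :: w); rewrite /= ws; split=> //.
    by move: wl; case: (chain_pos w).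
  have [qr|qr] := ltnP q r'.
    have [w [ws wl xw wz wc]] := IH _ _ _ _ _ _ Ex Ey Ez (ltac:(lia) : p < q < r').
    exists (false :: w); rewrite /= ws; split=> //; last by lia.
    by move: wl; case: (chain_pos w).
  (* Now [q = r'] is the top position for [c]. As [x'] lies below it, [true :: x'] falls in the
     chain [false :: c], shorter by two. *)
  have szx : size x' = size z' by rewrite -(size_chain x') -(size_chain z') Ex Ez.
  have := chain_pos_rank Ex; have := chain_pos_rank Ez => rz rx.
  exists (true :: x'); split=> //=.
  - by rewrite Ex; case: ifP => /eqP ?; rewrite /=; lia.
  - exact: word_le_refl.
  - by apply: chain_pos_le Ex Ez _; lia.
  - lia.
- move=> /chain_pos_falseP[x' -> [Ex xl]] /chain_pos_falseP[y' _ [Ey yl]].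
  move=> /chain_pos_falseP[z' -> [Ez zl]] pqr.
  have [w [ws wl xw wz wc]] := IH _ _ _ _ _ _ Ex Ey Ez pqr.
  exists (true :: w); rewrite /= ws; split=> //.
  case Ew: (chain_pos w) wl => [cw pw] /= wl.
  have szx : size x' = size z' by rewrite -(size_chain x') -(size_chain z') Ex Ez.
  have := chain_pos_rank Ez; have := chain_pos_rank Ew; have := chain_pos_lt Ew.
  by case: ifP => [/eqP|/eqP] ? /=; rewrite -?subn1; lia.
Qed.

Lemma chain_pos_surj x c p q : chain_pos x = (c, p) -> q < chain_size c ->
  exists2 y, size y = size x & chain_pos y = (c, q).
Proof.
elim: c x p q => [|[] c IH] x p q.
- move=> E /= q1; exists x => //; rewrite (chain_pos_nilP E) /=; congr (_, _); lia.
- move=> E /= qc.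
  have [x' [p' [Ex' sx]]] : exists x' p', chain_pos x' = (c, p') /\ size x = (size x').+1.
    by case/chain_pos_trueP: E => [[x' -> Ex]|[x' -> [p' Ex _]]]; exists x'; [exists p|exists p'].
  have [qlt|qge] := ltnP q (chain_size c).
    have [y sy Ey] := IH _ _ _ Ex' qlt.
    by exists (false :: y); rewrite /= ?sy ?sx ?Ey.
  have [y sy Ey] := IH _ _ (chain_size c).-1 Ex' ltac:(have := chain_pos_lt Ex'; lia).
  exists (true :: y); first by rewrite /= sy sx.
  have := chain_pos_lt Ex'; rewrite /= Ey; case: ifP => /eqP ? ?; last lia.
  by congr (_, _); lia.
- move=> /chain_pos_falseP[x' -> [Ex _]] /= qc.
  have [y sy Ey] := IH _ _ q Ex ltac:(lia).
  exists (true :: y); first by rewrite /= sy.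
  by rewrite /= Ey; case: ifP => // /eqP; lia.
Qed.

(** * Symmetric chains of subsets *)

Section SetChains.
Variable n : nat.
Implicit Types (X Y Z : {set 'I_n}).

Definition word X : seq bool := [seq i \in X | i <- enum 'I_n].

Lemma size_word X : size (word X) = n.
Proof. by rewrite size_map size_enum_ord. Qed.

Lemma nth_word X (i : 'I_n) : nth false (word X) i = (i \in X).
Proof. by rewrite (nth_map i) ?size_enum_ord // nth_ord_enum. Qed.

Lemma count_word X : count id (word X) = #|X|.
Proof.
rewrite count_map cardE [enum X]/enum_mem size_filter -enumT.
by apply: eq_count.
Qed.

Lemma word_surj (w : seq bool) : size w = n -> exists X, word X = w.
Proof.
move=> sw; exists [set i : 'I_n | nth false w i].
apply: (@eq_from_nth _ false); rewrite size_word // => i lin.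
by rewrite (nth_word _ (Ordinal lin)) inE.
Qed.

Lemma word_leE X Y : word_le (word X) (word Y) = (X \subset Y).
Proof.
transitivity (all (fun i => (i \in X) ==> (i \in Y)) (enum 'I_n)).
  by rewrite /word_le /word; elim: (enum 'I_n) => //= i s ->.
apply/allP/subsetP => [H i|H i _]; last by apply/implyP; exact: H.
by apply/implyP/H; rewrite mem_enum.
Qed.

Definition set_chain X := (chain_pos (word X)).1.

Lemma set_chainP X : {p | chain_pos (word X) = (set_chain X, p)}.
Proof. by exists (chain_pos (word X)).2; rewrite /set_chain; case: chain_pos. Qed.

Lemma set_chain_total X Y : set_chain X = set_chain Y -> (X \subset Y) || (Y \subset X).
Proof.
have [p Ep] := set_chainP X; have [q Eq] := set_chainP Y => E.
rewrite -!word_leE; rewrite E in Ep; case/orP: (leq_total p q) => pq.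
  by rewrite (chain_pos_le Ep Eq pq).
by rewrite (chain_pos_le Eq Ep pq) orbT.
Qed.

Lemma set_chain_between X Y Z :
  set_chain Y = set_chain X -> set_chain Z = set_chain X -> X \proper Y -> Y \proper Z ->
  exists2 V, chain_size (set_chain V) < chain_size (set_chain X) & (X \subset V) && (V \subset Z).
Proof.
have [p Ep] := set_chainP X; have [q Eq] := set_chainP Y.
have [r Er] := set_chainP Z => EY EZ XY YZ; rewrite EY in Eq; rewrite EZ in Er.
have pq : p < q.
  rewrite ltnNge; apply: contraL XY => qp.
  by rewrite properE -!word_leE (chain_pos_le Eq Ep qp) andbF.
have qr : q < r.
  rewrite ltnNge; apply: contraL YZ => rq.
  by rewrite properE -!word_leE (chain_pos_le Er Eq rq) andbF.
have [w [ws wl xw wz _]] := chain_pos_between Ep Eq Er (introT andP (conj pq qr)).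
have [V Vw] : exists V, word V = w by apply: word_surj; rewrite ws size_word.
by exists V; rewrite /set_chain ?Vw // -!word_leE Vw xw.
Qed.

Lemma set_chain_mid X :
  exists2 Y, Y \in [set Y : {set 'I_n} | #|Y| == n./2] & set_chain Y = set_chain X.
Proof.
have [p Ep] := set_chainP X.
have := chain_pos_rank Ep; have := chain_pos_lt Ep; rewrite size_word => lt' rk.
(* The symmetric chain reaches rank [n./2]. Adding before the truncated subtraction also covers a
   move down from [p]. *)
have [y sy Ey] := @chain_pos_surj _ _ _ (p + n./2 - count id (word X)) Ep ltac:(lia).
have [Y Yy] : exists Y, word Y = y by apply: word_surj; rewrite sy size_word.
exists Y; last by rewrite /set_chain Yy Ey.
rewrite inE -count_word Yy; have := chain_pos_rank Ey; rewrite sy size_word; lia.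
Qed.
End SetChains.

Lemma card_up_closed_ord n :
  #|[set F : {set {set 'I_n}} | up_closed F]| <= 3 ^ 'C(n, n./2).
Proof.
rewrite -[X in 'C(X, _)](card_ord n) -card_draws.
exact: (card_up_closed (@set_chain_total n) (@set_chain_between n) (@set_chain_mid n)).
Qed.

Lemma lambda_le n : lambda n <= 3 ^ 'C(n, n./2).
Proof.
apply: leq_trans (card_up_closed_ord n); rewrite /lambda; apply/subset_leq_card/subsetP => M.
rewrite !inE => /andP[maxM _]; apply/forall_inP => X XM; apply/forallP => Y.
by apply/implyP; exact: max_up.
Qed.

(** * Central binomial coefficients *)

Lemma central_bin_odd m : 'C(m.*2.+1, m.+1) = 'C(m.*2.+1, m).
Proof.
apply/eqP; rewrite -(eqn_pmul2l (ltn0Sn m)) mul_bin_left.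
by have -> : m.*2.+1 - m = m.+1 by lia.
Qed.

Lemma central_bin_evenS m : 'C(m.+1.*2, m.+1) = 2 * 'C(m.*2.+1, m).
Proof. by rewrite doubleS binS central_bin_odd; lia. Qed.

(** The coefficient grows by [2 * (2 * m + 1) / (m + 1)], and [(2 * m + 1) * (2 * m + 3) <= 4 * (m +
    1) ^ 2] closes the induction. *)
Lemma central_bin_even_bound m : 'C(m.*2, m) ^ 2 * m.*2.+1 <= 16 ^ m.
Proof.
elim: m => [|m IH] //.
have E : m.+1 * 'C(m.+1.*2, m.+1) = 2 * (m.*2.+1 * 'C(m.*2, m)).
  by rewrite central_bin_evenS -central_bin_odd (mul_bin_diag m.*2.+1 m) mulnCA.
move: E IH; set c' := 'C(m.+1.*2, _); set c := 'C(_, m) => E IH.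
rewrite -(@leq_pmul2l (m.+1 ^ 2)) ?expn_gt0 // mulnA -expnMn E [16 ^ m.+1]expnS.
have -> : (2 * (m.*2.+1 * c)) ^ 2 * m.+1.*2.+1 =
  4 * (m.*2.+1 * m.+1.*2.+1) * (c ^ 2 * m.*2.+1) by rewrite !expnMn; ring.
have -> : m.+1 ^ 2 * (16 * 16 ^ m) = 4 * (4 * m.+1 ^ 2) * 16 ^ m by ring.
by apply: leq_mul => //; rewrite leq_mul2l /=; rewrite -!mul2n; nia.
Qed.

Lemma central_bin_bound n : 'C(n, n./2) ^ 2 * n <= 4 ^ n.
Proof.
have E4 m : 4 ^ m.*2 = 16 ^ m by rewrite -mul2n expnM.
rewrite -[in X in X <= _](odd_double_half n) -[in X in _ <= X](odd_double_half n).
move: n./2 => m; case: (odd n); rewrite ?add0n ?add1n /=.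
  have := central_bin_even_bound m.+1; rewrite central_bin_evenS uphalf_double.
  rewrite [4 ^ _]expnS E4 [16 ^ m.+1]expnS expnMn; set c := 'C(_, _) ^ 2; rewrite doubleS.
  move=> H; have : c * m.*2.+1 <= c * m.*2.+3 by rewrite leq_mul2l; lia.
  lia.
rewrite doubleK E4; apply: leq_trans (central_bin_even_bound m).
by rewrite leq_mul2l leqnSn orbT.
Qed.

(** * Numerical estimates *)

Lemma leq_succ_exp3 n : 3 <= n -> n.+1 <= 2 ^ (3 ^ (n - 2)).
Proof.
move=> n3; apply: leq_trans (_ : 2 ^ n <= _); first by rewrite ltn_expl.
rewrite leq_exp2l //; have -> : n = (n - 3) + 3 by lia.
rewrite -addnBA //; move: (n - 3) => m; elim: m => //= m IH.
by rewrite !addSn expnS; lia.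
Qed.

Lemma exp3_pred n : 2 <= n -> 3 ^ n.-1 = 3 * 3 ^ (n - 2).
Proof. by case: n => [|[|n]] //= _; rewrite subn2 expnS. Qed.

(** With [x = 2 ^ (3 ^ (n - 2))] the right side is [n * x ^ 3], so [n + 1 <= x] suffices. *)
Lemma bin2_exp3_bound n : 3 <= n ->
  n.+1 * ('C(n, 2) * 2 ^ (3 ^ (n - 2))) <= n * 2 ^ (3 ^ n.-1).
Proof.
move=> n3; have := leq_succ_exp3 n3; rewrite exp3_pred; last by lia.
rewrite mulnC (mulnC 3) expnM; set x := 2 ^ _ => nx.
have E : 2 * 'C(n, 2) = n * n.-1 by rewrite -[RHS](congr1 (muln n) (bin1 _)) mul_bin_diag.
have : n.+1 * n.+1 <= x * x by apply: leq_mul.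
have : n.+1 * 'C(n, 2) <= n * (n.+1 * n.+1) by nia.
rewrite !expnS expn0 muln1 => h1 h2.
have : n.+1 * 'C(n, 2) <= n * (x * x) by apply: leq_trans h1 _; rewrite leq_mul2l h2 orbT.
by rewrite -(leq_pmul2r (_ : 0 < x)) ?expn_gt0 //; lia.
Qed.

(** A relative error of [1 / (n + 1)], cleared of denominators to fit [dist_ratio_le]. *)
Lemma Zcap_lower n : 3 <= n ->
  n.+1 * (n * 2 ^ (3 ^ n.-1)) <= n.+1 * Zcap n + n * 2 ^ (3 ^ n.-1).
Proof.
move=> n3; have := bin2_exp3_bound n3; have := Zcap_ge n.
rewrite -(leq_pmul2l (ltn0Sn n)) mulnDr => h1 h2.
by apply: leq_trans h1 _; rewrite leq_add2l.
Qed.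

(** The correction in [Zcap_ge] costs at most one of the [n] main terms, whence the denominator
    [n - 1] in [Rnt_Zcap_upper]. *)
Lemma Zcap_lower_pred n : 3 <= n -> n.-1 * 2 ^ (3 ^ n.-1) <= Zcap n.
Proof.
move=> n3; have := bin2_exp3_bound n3; have := Zcap_ge n.
set x := 2 ^ (3 ^ n.-1); set b := 'C(n, 2) * _ => h1 h2.
have : b <= x.
  rewrite -(leq_pmul2l (ltn0Sn n)); apply: leq_trans h2 _.
  by rewrite leq_mul2r leqnSn orbT.
by case: n n3 x b h1 h2 => //= n _ x b; rewrite mulSn; lia.
Qed.

Lemma Zcap_gt0 n : 3 <= n -> 0 < Zcap n.
Proof.
move=> n3; apply: leq_trans (Zcap_lower_pred n3).
by rewrite muln_gt0 expn_gt0 andbT; lia.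
Qed.

(** Turns the factor [3] of [sum_HM] into [3 / 4] of [2 ^ Mstar n]. *)
Lemma exp2_Mstar n : 2 ^ Mstar n = 4 * 2 ^ (3 ^ n.-1 - 2 ^ n.-1).
Proof. by rewrite /Mstar expnD mulnC. Qed.

Lemma exp3_pred_ge n : 6 <= n -> 2 ^ n.-1 + n.*2 + 4 <= 2 * 3 ^ (n - 2).
Proof.
move=> n6; have -> : n = (n - 6) + 6 by lia.
move: (n - 6) => m; rewrite -addnBA // !addnS addn0 /=.
elim: m => [|m IH] //; rewrite !addSn expnS (expnS 3); lia.
Qed.

Lemma Rnt_lower n : 6 <= n ->
  n.+1 * (3 * (n * 2 ^ Mstar n)) <= n.+1 * (4 * Rnt n) + n * 2 ^ Mstar n.
Proof.
move=> n6; have := @Rnt_ge_HM n ltac:(lia); rewrite exp2_Mstar.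
set x := 2 ^ (_ - _); set b := n * 2 ^ (_ + _) => H.
suff Hb : n.+1 * b <= x.
  have : n.+1 * (n * b) <= n * x by rewrite mulnCA leq_mul2l Hb orbT.
  have : n.+1 * (n * (3 * x)) <= n.+1 * (Rnt n + n * b) by rewrite leq_mul2l H orbT.
  lia.
rewrite /b mulnA; apply: (@leq_trans (2 ^ (n.*2 + 3 ^ (n - 2) + 4))).
  rewrite -addnA [2 ^ (n.*2 + _)]expnD leq_mul2r; apply/orP; right.
  by rewrite -addnn expnD; apply: leq_mul; [|apply: ltnW]; rewrite ltn_expl.
rewrite leq_exp2l // exp3_pred; last by lia.
have := exp3_pred_ge n6; lia.
Qed.

(** As [1024 = 32 ^ 2], the central coefficient is at most [2 ^ n / 32]; replacing the base [3] by
    [2 ^ 2] doubles the exponent. *)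
Lemma lambda_le_exp2 n : 1024 <= n -> lambda n <= 2 ^ (2 ^ (n - 4)).
Proof.
move=> n1024; apply: leq_trans (lambda_le n) _.
have := central_bin_bound n; set c := 'C(_, _) => H.
have H2 : (32 * c) ^ 2 <= (2 ^ n) ^ 2.
  rewrite -expnM (mulnC n) expnM; apply: leq_trans H.
  by rewrite expnMn -[32 ^ 2]/1024 mulnC leq_mul2l n1024 orbT.
have {}H2 : 32 * c <= 2 ^ n by rewrite leq_exp2r in H2.
apply: (@leq_trans ((2 ^ 2) ^ c)); first by case: (c) => // k; rewrite leq_exp2r.
rewrite -expnM leq_exp2l //.
have : 2 ^ n = 2 ^ 4 * 2 ^ (n - 4) by rewrite -expnD; congr (2 ^ _); lia.
rewrite -[2 ^ 4]/16; lia.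
Qed.

Lemma leq_exp3_exp2 k : 3 * 2 ^ k <= 3 * 3 ^ k.
Proof. by case: k => // k; rewrite leq_mul2l leq_exp2r. Qed.

Lemma Rnt_upper n : 1024 <= n ->
  n.+1 * (4 * Rnt n) <= n.+1 * (3 * (n * 2 ^ Mstar n)) + n * 2 ^ Mstar n.
Proof.
move=> n1024; have := @Rnt_le_HM n ltac:(lia).
have := lambda_le_exp2 n1024; set l := lambda n => Hl.
set b := l * _ => H.
suff Hb : n.+1 * (4 * b) <= n * 2 ^ Mstar n.
  move: Hb; rewrite exp2_Mstar; set x := 2 ^ (3 ^ _ - _) in H *.
  have : n.+1 * Rnt n <= n.+1 * (n * (3 * x) + b) by rewrite leq_mul2l H orbT.
  lia.
(* In units of [2 ^ (n - 4)] the exponent drops by [4] and [lambda] costs [1]; the rest absorbs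
   [4 * (n + 1)] and the additive [4]. *)
have e4 : 2 ^ n = 16 * 2 ^ (n - 4) by rewrite -[16]/(2 ^ 4) -expnD; congr (2 ^ _); lia.
have e2 : 2 ^ (n - 2) = 4 * 2 ^ (n - 4) by rewrite -[4]/(2 ^ 2) -expnD; congr (2 ^ _); lia.
have e1 : 2 ^ n.-1 = 8 * 2 ^ (n - 4) by rewrite -[8]/(2 ^ 3) -expnD; congr (2 ^ _); lia.
have n_le : n + 6 <= 2 ^ (n - 4).
  have -> : n = (n - 8) + 8 by lia.
  rewrite -addnBA //; move: (n - 8) => m; elim: m => [|m IH] //=; rewrite !addSn expnS; lia.
(* This makes the subtraction in the exponent exact. *)
have M_ge : 2 ^ (n - 2) <= Mstar n.
  rewrite /Mstar exp3_pred; last by lia.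
  have := leq_exp3_exp2 (n - 2); lia.
apply: (@leq_trans (2 ^ (n + 2 + 2 ^ (n - 4) + (Mstar n + 4 - 2 ^ (n - 2))))).
  rewrite /b expnD [2 ^ (n + 2 + _)]expnD [2 ^ (n + 2)]expnD -[2 ^ 2]/4.
  rewrite (mulnA 4) (mulnA n.+1) (mulnA n.+1) leq_mul2r.
  apply/orP; right; apply: leq_mul => //; apply: leq_mul => //.
  by rewrite ltn_expl.
apply: (@leq_trans (1 * 2 ^ Mstar n)); last by rewrite leq_mul2r; apply/orP; right; lia.
rewrite mul1n leq_exp2l //; lia.
Qed.

(** * Asymptotics *)

From mathcomp Require Import all_classical all_reals all_analysis.
Import Order.TTheory GRing.Theory Num.Theory.
Import numFieldNormedType.Exports.
Local Open Scope classical_set_scope.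
Local Open Scope ring_scope.

Section Asymptotics.
Variable R : realType.

(** [T] is the leading term of [Zcap], [Y] the scale of [Rnt], [supp] the suppression exponent
    (exact for [2 <= n]) and [rho] the ratio freed of it. *)
Let T n : R := n%:R * 2 ^+ (3 ^ n.-1)%N.
Let Y n : R := n%:R * 2 ^+ Mstar n.
Let supp n : nat := (2 ^ n.-1 - 2)%N.
Let rho n : R := (Rnt n)%:R / (Zcap n)%:R * 2 ^+ supp n.

Lemma cvg_harmonic_bound (u : nat -> R) (l : R) (N : nat) :
  (forall n, (N <= n)%N -> `|u n - l| <= n.+1%:R^-1) -> u n @[n --> \oo] --> l.
Proof.
move=> Hu; apply/cvgrPdist_le => e e0; near=> n.
rewrite distrC (le_trans (Hu n _)) //; first by near: n; exact: nbhs_infty_ge.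
near: n; have /cvgrPdist_le /(_ e e0) := @cvg_harmonic R.
by apply: filterS => k; rewrite sub0r normrN /harmonic ger0_norm ?invr_ge0.
Unshelve. all: by end_near. Qed.

Lemma dist_ratio_le (a x q : R) n : 0 < x ->
  n.+1%:R * (q * x) <= n.+1%:R * a + x -> n.+1%:R * a <= n.+1%:R * (q * x) + x ->
  `|a / x - q| <= n.+1%:R^-1.
Proof.
move=> x0 h1 h2; have n0 : (0 : R) < n.+1%:R by rewrite ltr0n.
have -> : a / x - q = (a - q * x) / x by field; rewrite gt_eqF.
rewrite normrM normfV (gtr0_norm x0) ler_pdivrMr // [leRHS]mulrC ler_pdivlMr //.
rewrite -{1}(gtr0_norm n0) -normrM ler_norml; apply/andP; split; lra.
Qed.

Let T_gt0 n : (0 < n)%N -> 0 < T n.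
Proof. by move=> n0; rewrite mulr_gt0 ?ltr0n // exprn_gt0. Qed.

Let Y_gt0 n : (0 < n)%N -> 0 < Y n.
Proof. by move=> n0; rewrite mulr_gt0 ?ltr0n // exprn_gt0. Qed.

Lemma Zcap_cvg : (Zcap n)%:R / T n @[n --> \oo] --> (1 : R).
Proof.
apply: (@cvg_harmonic_bound _ _ 3) => n n3; apply: dist_ratio_le; first by apply: T_gt0; lia.
  by have := Zcap_lower n3; rewrite -(ler_nat R) !(natrD, natrM, natrX) mul1r.
rewrite mul1r; apply: ler_wpDr; first by apply/ltW/T_gt0; lia.
by rewrite ler_wpM2l //; have := Zcap_le n; rewrite -(ler_nat R) !(natrM, natrX).
Qed.

Lemma Rnt_cvg : (Rnt n)%:R / Y n @[n --> \oo] --> (3 / 4 : R).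
Proof.
have H : (4 * (Rnt n)%:R) / Y n @[n --> \oo] --> (3 : R).
  apply: (@cvg_harmonic_bound _ _ 1024) => n n1024; apply: dist_ratio_le.
  - by apply: Y_gt0; lia.
  - by have := @Rnt_lower n ltac:(lia); rewrite -(ler_nat R) !(natrD, natrM, natrX).
  - by have := @Rnt_upper n n1024; rewrite -(ler_nat R) !(natrD, natrM, natrX).
have -> : (fun n => (Rnt n)%:R / Y n) = (fun n => (4 * (Rnt n)%:R) / Y n * 4^-1).
  by apply/funext => n; rewrite [RHS]mulrC !mulrA mulVf ?mul1r // pnatr_eq0.
by apply: cvgM H _; exact: cvg_cst.
Qed.

Let Mstar_supp n : (2 <= n)%N -> (Mstar n + supp n)%N = (3 ^ n.-1)%N.
Proof.
move=> n2; rewrite /Mstar /supp.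
have h : (2 ^ n.-1 <= 3 ^ n.-1)%N by rewrite leq_exp2r //; lia.
have : (2 ^ 1 <= 2 ^ n.-1)%N by rewrite leq_exp2l //; lia.
by lia.
Qed.

Let T_Y n : (2 <= n)%N -> T n = Y n * 2 ^+ supp n.
Proof. by move=> n2; rewrite /T -(@Mstar_supp n n2) exprD mulrA. Qed.

Lemma rho_cvg : rho n @[n --> \oo] --> (3 / 4 : R).
Proof.
have H : ((Rnt n)%:R / Y n) / ((Zcap n)%:R / T n) @[n --> \oo] --> (3 / 4 / 1 : R).
  by apply: cvgM; [exact: Rnt_cvg|apply: cvgV => //; exact: Zcap_cvg].
rewrite divr1 in H; apply: cvg_trans H; apply: near_eq_cvg; near=> n.
have n3 : (3 <= n)%N by near: n; exact: nbhs_infty_ge.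
have Z0 : (Zcap n)%:R != 0 :> R by rewrite pnatr_eq0 -lt0n; exact: Zcap_gt0.
rewrite /rho T_Y; last lia.
have Y0 : Y n != 0 by rewrite gt_eqF // Y_gt0 //; lia.
have t0 : 2 ^+ supp n != 0 :> R by rewrite gt_eqF // exprn_gt0.
by field; rewrite Z0 t0 Y0.
Unshelve. all: by end_near. Qed.

Let rho_gt0 : \forall n \near \oo, 0 < rho n.
Proof. by apply: (cvgr_gt (3 / 4)); [exact: rho_cvg|lra]. Qed.

Let exp2_inv_cvg : (2 ^+ n.-1)^-1 @[n --> \oo] --> (0 : R).
Proof.
apply: (@cvg_harmonic_bound _ _ 4) => n n4.
rewrite subr0 ger0_norm ?invr_ge0 ?exprn_ge0 // lef_pV2 ?posrE ?exprn_gt0 ?ltr0n //.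
rewrite -natrX ler_nat; case: n n4 => // n; rewrite ltnS /=.
elim: n => [|n IH] // n3; rewrite expnS; have [->//|n3'] := eqVneq n 2%N.
by have := IH ltac:(lia); lia.
Qed.

Let exp2_supp_inv_cvg : (2 ^+ supp n)^-1 @[n --> \oo] --> (0 : R).
Proof.
have H : 4 * (2 ^+ n.-1)^-1 @[n --> \oo] --> (4 * 0 : R).
  by apply: cvgM; [exact: cvg_cst|exact: exp2_inv_cvg].
rewrite mulr0 in H.
apply: (squeeze_cvgr (f := fun=> 0)); [|exact: cvg_cst|exact: H].
near=> n; rewrite invr_ge0 exprn_ge0 //=.
have n2 : (2 <= n)%N by near: n; exact: nbhs_infty_ge.
have h : (n.-1 <= supp n + 2)%N by rewrite /supp; have := ltn_expl n.-1 (isT : (1 < 2)%N); lia.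
have -> : (4 : R) = 2 ^+ 2 by rewrite -natrX.
rewrite ler_pdivlMr ?exprn_gt0 // mulrC ler_pdivrMr ?exprn_gt0 // -exprD addnC.
by apply: ler_weXn2l; rewrite ?ler1n.
Unshelve. all: by end_near. Qed.

Lemma equivalent_cvg (f g : nat -> R) : (\forall n \near \oo, 0 < g n) ->
  f n / g n @[n --> \oo] --> (1 : R) -> (f : nat -> R^o) ~_\oo (g : nat -> R^o).
Proof.
move=> g0 fg; apply/eqaddoP => e e0.
near=> n; have gn : 0 < g n by near: n.
have : `|1 - f n / g n| <= e by near: n; move/cvgrPdist_le: fg => /(_ e e0).
rewrite distrC => H; rewrite /= (gtr0_norm gn).
have -> : (f - g) n = (f n / g n - 1) * g n by rewrite mulrBl mul1r divfK ?gt_eqF.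
by rewrite normrM (gtr0_norm gn) ler_wpM2r // ltW.
Unshelve. all: by end_near. Qed.

Lemma Zcap_equiv : (fun n : nat => (Zcap n)%:R : R^o) ~_\oo
  (fun n : nat => n%:R * 2 ^+ (3 ^ n.-1)%N : R^o).
Proof.
apply: (@equivalent_cvg (fun n => (Zcap n)%:R) T); last exact: Zcap_cvg.
by near=> n; apply: T_gt0; near: n; exact: nbhs_infty_gt.
Unshelve. all: by end_near. Qed.

Lemma W_equiv : (fun n : nat => (W n)%:R : R^o) ~_\oo
  (fun n : nat => n%:R * 2 ^+ (3 ^ n.-1)%N : R^o).
Proof.
apply: (@equivalent_cvg (fun n => (W n)%:R) T).
  by near=> n; apply: T_gt0; near: n; exact: nbhs_infty_gt.
(* As [T n = Y n * 2 ^+ supp n], the share of [Rnt] is a convergent ratio times a vanishing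
   factor. *)
have H : (Zcap n)%:R / T n + (Rnt n)%:R / Y n * (2 ^+ supp n)^-1 @[n --> \oo]
    --> (1 + 3 / 4 * 0 : R).
  apply: cvgD; first exact: Zcap_cvg.
  by apply: cvgM; [exact: Rnt_cvg|exact: exp2_supp_inv_cvg].
rewrite mulr0 addr0 in H; apply: cvg_trans H; apply: near_eq_cvg; near=> n.
have n2 : (2 <= n)%N by near: n; exact: nbhs_infty_ge.
by rewrite WE natrD mulrDl; congr (_ + _); rewrite (T_Y n2) [(Y n * _)^-1]invfM mulrA.
Unshelve. all: by end_near. Qed.

Lemma Rnt_Zcap_upper n : (3 <= n)%N ->
  (Rnt n)%:R / (Zcap n)%:R <= (lambda n)%:R / (n%:R - 1) * 2 ^- supp n :> R.
Proof.
move=> n3.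
have n1 : 0 < n%:R - 1 :> R by rewrite subr_gt0 ltr1n; lia.
have Z0 : 0 < (Zcap n)%:R :> R by rewrite ltr0n Zcap_gt0.
rewrite ler_pdivrMr //; have := Rnt_le_lambda n3.
rewrite -(ler_nat R) natrM natrX => /le_trans; apply.
rewrite -!mulrA ler_wpM2l // ler_pdivlMl // ler_pdivlMl ?exprn_gt0 //.
rewrite mulrCA -exprD addnC Mstar_supp; last lia.
have := Zcap_lower_pred n3; rewrite -(ler_nat R) natrM natrX; apply: le_trans.
by rewrite -subn1 natrB //; lia.
Qed.

Let Rnt_ZcapE n : (Rnt n)%:R / (Zcap n)%:R = rho n * 2 ^- supp n.
Proof. by rewrite /rho mulfK // gt_eqF // exprn_gt0. Qed.

Lemma Rnt_Zcap_lower : exists2 e : nat -> R, e n @[n --> \oo] --> 0 &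
  \forall n \near \oo, (Rnt n)%:R / (Zcap n)%:R >= (3 / 4 - e n) * 2 ^- supp n.
Proof.
(* With this error term the bound is an equality. *)
exists (fun n => 3 / 4 - rho n).
  rewrite -[X in _ --> X](subrr (3 / 4)); apply: cvgB; first exact: cvg_cst.
  exact: rho_cvg.
by near=> n; rewrite Rnt_ZcapE subKr.
Unshelve. all: by end_near. Qed.

Lemma Rnt_asymp : exists2 e : nat -> R, e n @[n --> \oo] --> 0 &
  \forall n \near \oo, (Rnt n)%:R = (3 / 4 + e n) * n%:R * 2 ^+ Mstar n.
Proof.
exists (fun n => (Rnt n)%:R / Y n - 3 / 4).
  by rewrite -[X in _ --> X](subrr (3 / 4)); apply: cvgB; [exact: Rnt_cvg|exact: cvg_cst].
near=> n; have n0 : (0 < n)%N by near: n; exact: nbhs_infty_gt.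
by rewrite addrC subrK -mulrA divfK // gt_eqF // Y_gt0.
Unshelve. all: by end_near. Qed.

Let ln2_gt0 : 0 < ln (2 : R).
Proof. by rewrite ln_gt0 // ltr1n. Qed.

Lemma log2_rho_cvg : log2 (rho n) @[n --> \oo] --> (- log2 (4 / 3) : R).
Proof.
have -> : - log2 (4 / 3) = ln (3 / 4) / ln 2 :> R.
  by rewrite /log2 -mulNr -lnV ?posrE ?invf_div //; lra.
apply: cvgM; last exact: cvg_cst.
apply: (@cvg_comp _ _ _ (fun n => rho n) (@ln R) _ _ _ rho_cvg).
by apply: continuous_ln; lra.
Qed.

Let log2_ratio : \forall n \near \oo,
  log2 ((Zcap n)%:R / (Rnt n)%:R) = 2 ^+ n.-1 - 2 - log2 (rho n) :> R.
Proof.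
near=> n; have n2 : (2 <= n)%N by near: n; exact: nbhs_infty_ge.
have r0 : 0 < rho n by near: n; exact: rho_gt0.
rewrite -[(Zcap n)%:R / _]invf_div Rnt_ZcapE invfM invrK /log2.
rewrite lnM ?posrE ?invr_gt0 ?exprn_gt0 // lnV ?posrE // lnXn //.
rewrite mulrDl mulNr addrC -[ln 2 *+ _]mulr_natl mulfK ?gt_eqF //; congr (_ - _).
rewrite /supp natrB ?natrX //.
by have := @leq_exp2l 2 1 n.-1 isT; rewrite expn1 => ->; lia.
Unshelve. all: by end_near. Qed.

Lemma log2_Zcap_Rnt : exists2 e : nat -> R, e n @[n --> \oo] --> 0 &
  \forall n \near \oo,
    log2 ((Zcap n)%:R / (Rnt n)%:R) = 2 ^+ n.-1 - 2 + log2 (4 / 3) + e n.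
Proof.
exists (fun n => - log2 (4 / 3) - log2 (rho n)).
  rewrite -[X in _ --> X](subrr (- log2 (4 / 3))); apply: cvgB; first exact: cvg_cst.
  exact: log2_rho_cvg.
apply: filterS log2_ratio => n ->; ring.
Qed.

Lemma log2_Zcap_Rnt_leading : exists2 e : nat -> R, e n @[n --> \oo] --> 0 &
  \forall n \near \oo, log2 ((Zcap n)%:R / (Rnt n)%:R) = 2 ^+ n.-1 * (1 + e n).
Proof.
exists (fun n => (- 2 - log2 (rho n)) * (2 ^+ n.-1)^-1).
  have H : (- 2 - log2 (rho n)) * (2 ^+ n.-1)^-1 @[n --> \oo]
      --> ((- 2 - - log2 (4 / 3)) * 0 : R).
    apply: cvgM; last exact: exp2_inv_cvg.
    by apply: cvgB; [exact: cvg_cst|exact: log2_rho_cvg].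
  by rewrite mulr0 in H.
apply: filterS log2_ratio => n ->.
by rewrite mulrDr mulr1 mulrCA mulfV ?mulr1 ?addrA // gt_eqF // exprn_gt0.
Qed.

Lemma log2_lambda_bigO : (fun n : nat => log2 (lambda n)%:R : R^o) =O_\oo
  (fun n : nat => 2 ^+ n / Num.sqrt n%:R : R^o).
Proof.
apply/eqOP; near=> k; near=> n.
(* The constant [2] comes from [3 <= 2 ^ 2] applied to [lambda_le]. *)
have k2 : 2 <= k by near: k; exact: nbhs_pinfty_ge.
have n0 : 0 < n%:R :> R by rewrite ltr0n; near: n; exact: nbhs_infty_gt.
have s0 : 0 < Num.sqrt n%:R :> R by rewrite sqrtr_gt0.
rewrite /= [X in _ <= _ * X]ger0_norm ?divr_ge0 ?exprn_ge0 //.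
apply: (@le_trans _ _ (2 * (2 ^+ n / Num.sqrt n%:R))); last first.
  by rewrite ler_wpM2r // divr_ge0 ?exprn_ge0.
have := central_bin_bound n; have := lambda_le n; set c := 'C(_, _) => Hl Hc.
apply: (@le_trans _ _ (2 * c%:R)).
  (* If [lambda n = 0], the convention [ln 0 = 0] applies. *)
  have [->|l0] := posnP (lambda n); first by rewrite /log2 ln0 // mul0r normr0 mulr_ge0.
  have l1 : 1 <= (lambda n)%:R :> R by rewrite ler1n.
  rewrite ger0_norm; last by apply: divr_ge0; [exact: ln_ge0|exact: ltW ln2_gt0].
  rewrite /log2 ler_pdivrMr //.
  have -> : 2 * c%:R * ln 2 = ln (2 ^+ (2 * c)) :> R.
    by rewrite lnXn // -natrM mulr_natl.
  rewrite ler_ln ?posrE ?exprn_gt0 ?ltr0n // -natrX ler_nat.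
  apply: leq_trans Hl _; rewrite expnM.
  by case: (c) => // d; rewrite leq_exp2r.
rewrite ler_wpM2l // ler_pdivlMr //.
rewrite -(@ler_pXn2r _ 2) ?nnegrE ?mulr_ge0 ?exprn_ge0 //.
rewrite exprMn sqr_sqrtr ?(ltW n0) // -!natrX -natrM ler_nat.
by rewrite -expnM (mulnC n) expnM.
Unshelve. all: by end_near. Qed.

Lemma exp2_sqrt_littleo : (fun n : nat => 2 ^+ n / Num.sqrt n%:R : R^o) =o_\oo
  (fun n : nat => 2 ^+ n.-1 : R^o).
Proof.
apply/eqoP => e e0; near=> n.
have n0 : (0 < n)%N by near: n; exact: nbhs_infty_gt.
have s0 : 0 < Num.sqrt n%:R :> R by rewrite sqrtr_gt0 ltr0n.
(* The quotient of the two functions is [2 / Num.sqrt n%:R], at most [e] from here on. *)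
have ns : (2 / e) ^+ 2 <= n%:R by near: n; exact: nbhs_infty_ger.
rewrite /= !ger0_norm ?divr_ge0 ?exprn_ge0 //.
rewrite -[in leLHS](prednK n0) exprS ler_pdivrMr // mulrAC ler_wpM2r ?exprn_ge0 //.
rewrite mulrC -ler_pdivrMr // -(ger0_norm (divr_ge0 _ (ltW e0))) // -sqrtr_sqr.
by rewrite ler_sqrt ?prednK ?ler0n ?ltr0n.
Unshelve. all: by end_near. Qed.

Lemma log2_lambda_littleo : (fun n : nat => log2 (lambda n)%:R : R^o) =o_\oo
  (fun n : nat => 2 ^+ n.-1 : R^o).
Proof. exact: eqOo_trans log2_lambda_bigO exp2_sqrt_littleo. Qed.
End Asymptotics.

Theorem theorem1p4 (R : realType) :
  (* W(n) ~ n 2^(3^(n-1)) *)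
  ((fun n : nat => (W n)%:R : R^o) ~_\oo
     (fun n : nat => n%:R * 2 ^+ (3 ^ n.-1)%N : R^o))
  /\
  (* Z(n): exact formula and asymptotics *)
  (forall n : nat,
     (Zcap n)%:Z =
     \sum_(1 <= j < n.+1) (-1) ^+ j.+1 * ('C(n, j))%:Z * 2 ^+ (3 ^ (n - j))%N)
  /\
  ((fun n : nat => (Zcap n)%:R : R^o) ~_\oo
     (fun n : nat => n%:R * 2 ^+ (3 ^ n.-1)%N : R^o))
  /\
  (* non-asymptotic upper bound *)
  (forall n : nat, (3 <= n)%N ->
     (Rnt n)%:R / (Zcap n)%:R
     <= (lambda n)%:R / (n%:R - 1) * 2 ^- (2 ^ n.-1 - 2)%N :> R)
  /\
  (* matching lower bound *)
  (exists2 e : nat -> R, e n @[n --> \oo] --> 0 &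
     \forall n \near \oo,
       (Rnt n)%:R / (Zcap n)%:R >= (3 / 4 - e n) * 2 ^- (2 ^ n.-1 - 2)%N)
  /\
  (* log_2 lambda(n) = O(2^n n^(-1/2)) = o(2^(n-1)) *)
  [/\ (fun n : nat => log2 (lambda n)%:R : R^o) =O_\oo
        (fun n : nat => 2 ^+ n / Num.sqrt n%:R : R^o),
      (fun n : nat => 2 ^+ n / Num.sqrt n%:R : R^o) =o_\oo
        (fun n : nat => 2 ^+ n.-1 : R^o) &
      (fun n : nat => log2 (lambda n)%:R : R^o) =o_\oo
        (fun n : nat => 2 ^+ n.-1 : R^o)]
  /\
  (* log_2 (Z(n) / R(n)) = 2^(n-1) (1 + o(1)) *)
  (exists2 e : nat -> R, e n @[n --> \oo] --> 0 &
     \forall n \near \oo,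
       log2 ((Zcap n)%:R / (Rnt n)%:R) = 2 ^+ n.-1 * (1 + e n))
  /\
  (* R(n) = (3/4 + o(1)) n 2^(M_n^* ) *)
  (exists2 e : nat -> R, e n @[n --> \oo] --> 0 &
     \forall n \near \oo,
       (Rnt n)%:R = (3 / 4 + e n) * n%:R * 2 ^+ Mstar n)
  /\
  (* log_2 (Z(n) / R(n)) = 2^(n-1) - 2 + log_2 (4/3) + o(1) *)
  (exists2 e : nat -> R, e n @[n --> \oo] --> 0 &
     \forall n \near \oo,
       log2 ((Zcap n)%:R / (Rnt n)%:R) =
       2 ^+ n.-1 - 2 + log2 (4 / 3) + e n).
Proof.
split; first exact: W_equiv.
split; first exact: Zcap_formula.
split; first exact: Zcap_equiv.
split; first exact: Rnt_Zcap_upper.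
split; first exact: Rnt_Zcap_lower.
split.
  by split; [exact: log2_lambda_bigO|exact: exp2_sqrt_littleo|exact: log2_lambda_littleo].
split; first exact: log2_Zcap_Rnt_leading.
split; first exact: Rnt_asymp.
exact: log2_Zcap_Rnt.
Qed.
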